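(* Let $X_o$ be a compact Hausdorff space, $\mu_o$ a Radon probability measure on $X_o$, and $T_o:X_o\to X_o$ a homeomorphism preserving $\mu_o$. Let $f:X_o\to\mathbb{T}$ be continuous, and on $X:=X_o\times\mathbb{T}$ consider the skew-product $T(x_o,z):=(T_ox_o,f(x_o)z)$, which preserves the measure $\mu:=\mu_o\times\mathrm{m}$. Suppose that the dynamical system $(C(X_o),T_o)$ is uniquely ergodic. Then the following are equivalent: (i) $\mu$ is an ergodic measure for the action of $T$; (ii) for each $n\in\mathbb{Z}\smallsetminus\{0\}$, the equation $g(T_ox_o)f(x_o)^n=g(x_o)$, $\mu_o$-a.e., has no non-zero solution $g\in L^\infty(X_o,\mu_o)$; (iii) the dynamical system $(C(X),T)$ is uniquely ergodic.
   Context: $\mathbb{T}=\{z\in\mathbb{C}:|z|=1\}$ is the unit circle and $\mathrm{m}$ its normalized Lebesgue (Haar) measure. For a homeomorphism $S$ of a compact Hausdorff space $Y$, the system $(C(Y),S)$ is uniquely ergodic if there is exactly one $S$-invariant Radon probability measure on $Y$ (equivalently, exactly one state of $C(Y)$ invariant under $h\mapsto h\circ S$). No metrizability of $X_o$ or separability of $L^2(X_o,\mu_o)$ is assumed. Measures on $X$ are Radon measures, $\mu_o\times\mathrm{m}$ being the Radon product measure. *)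

(* Defs.v *)
From HB Require Import structures.
From mathcomp Require Import all_boot all_order all_algebra complex.
From mathcomp Require Import all_classical all_reals all_analysis.
From mathcomp Require Import measurable_realfun.

Set Implicit Arguments.
Unset Strict Implicit.
Unset Printing Implicit Defensive.

Import Order.TTheory GRing.Theory Num.Theory numFieldNormedType.Exports.

Local Open Scope classical_set_scope.
Local Open Scope ring_scope.
Local Open Scope complex_scope.

(* Pointedness is only what [g_sigma_algebraType] asks for; it holds on every
   space carrying a probability measure. *)
Notation borel Y :=
  (@g_sigma_algebraType (PointedTopological.sort Y) (@open Y)).

HB.instance Definition _ (Y Z : ptopologicalType) := Pointed.on (Y * Z)%type.

(* [R[i]^o] is [R[i]] with the topology of its modulus. *)
Definition circle_set (R : realType) : set R[i]^o :=
  [set z | `|z : R[i]| = 1].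

Definition circle (R : realType) : Type := set_type (@circle_set R).

HB.instance Definition _ (R : realType) := Topological.on (circle R).

Section circle_group.
Variable R : realType.

Lemma circle_subproof (z : R[i]) : `|z| = 1 -> z \in @circle_set R.
Proof. by move=> z1; rewrite inE. Qed.

Definition Circle (z : R[i]) (z1 : `|z| = 1) : circle R :=
  exist _ (z : R[i]^o) (circle_subproof z1).

Definition circle_val (z : circle R) : R[i] := set_val z.

Lemma circle_norm (z : circle R) : `|circle_val z| = 1.
Proof. exact: set_mem (valP z). Qed.

Lemma circle_mul_subproof (z w : circle R) :
  `|circle_val z * circle_val w| = 1.
Proof. by rewrite normrM !circle_norm mulr1. Qed.

Definition circle_mul (z w : circle R) : circle R :=
  Circle (circle_mul_subproof z w).

HB.instance Definition _ := isPointed.Build (circle R) (Circle (normr1 R[i])).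

Lemma expi_subproof (t : R) : `|cos (2 * pi * t) +i* sin (2 * pi * t)| = 1.
Proof. by rewrite normc_def/= cos2Dsin2 sqrtr1. Qed.

Definition expi (t : R) : circle R := Circle (expi_subproof t).

End circle_group.

Section circle_topology.
Variable R : realType.

Lemma ltc_norm (z : R[i]) (e : R) :
  `|complex.Re z| < e / 2 -> `|complex.Im z| < e / 2 -> `|z| < e%:C.
Proof.
move=> rz iz; rewrite normc_def ltcR [e]splitr (le_lt_trans _ (ltrD rz iz))//.
rewrite -[leRHS]ger0_norm ?addr_ge0// -sqrtr_sqr ler_sqrt ?sqr_ge0//.
by rewrite sqrrD !real_normK ?num_real// lerD2r lerDl mulrn_wge0 ?mulr_ge0.
Qed.

Lemma nbhsCP (z : R[i]^o) (A : set R[i]^o) : nbhs z A ->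
  exists2 e : R, 0 < e & forall w : R[i],
    `|complex.Re w - complex.Re z| < e -> `|complex.Im w - complex.Im z| < e ->
    A w.
Proof.
move=> /nbhs_ballP[e /= e0 eA].
have eE : e = (complex.Re e)%:C by rewrite RRe_real// gtr0_real.
have e1 : 0 < complex.Re e by rewrite -ltcR -eE.
exists (complex.Re e / 2); first by rewrite divr_gt0.
move=> w rw iw; apply: eA; rewrite -ball_normE/= distrC eE.
by apply: ltc_norm; rewrite raddfB/=.
Qed.


Lemma nbhs_box (z : R[i]^o) (e : R) : 0 < e ->
  nbhs z [set w : R[i]^o | `|complex.Re (w : R[i]) - complex.Re (z : R[i])| < e /\
                           `|complex.Im (w : R[i]) - complex.Im (z : R[i])| < e].
Proof.
move=> e0; apply/nbhs_ballP; exists e%:C; first by rewrite /= ltcR.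
move=> w; rewrite -ball_normE/= distrC => wz.
have [h1 h2] : `|complex.Re (w - z : R[i])|%:C <= `|w - z : R[i]| /\
    `|complex.Im (w - z : R[i])|%:C <= `|w - z : R[i]|.
  split; first exact: normc_ge_Re.
  by rewrite normc_def lecR -sqrtr_sqr ler_sqrt ?addr_ge0 ?sqr_ge0// lerDr sqr_ge0.
by split; rewrite -raddfB -ltcR; [apply: le_lt_trans h1 _|apply: le_lt_trans h2 _].
Qed.

Definition box (c : rat * rat * nat) : set (circle R) :=
  [set w | `|complex.Re (circle_val w) - ratr c.1.1| < c.2.+1%:R^-1 /\
           `|complex.Im (circle_val w) - ratr c.1.2| < c.2.+1%:R^-1].

Lemma open_box c : open (box c).
Proof.
exists [set w : R[i]^o | `|complex.Re (w : R[i]) - ratr c.1.1| < c.2.+1%:R^-1 /\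
           `|complex.Im (w : R[i]) - ratr c.1.2| < c.2.+1%:R^-1] => //.
rewrite openE => z /= [rz iz]; rewrite /interior.
pose d := Num.min (c.2.+1%:R^-1 - `|complex.Re (z : R[i]) - ratr c.1.1|)
                  (c.2.+1%:R^-1 - `|complex.Im (z : R[i]) - ratr c.1.2|).
have d0 : 0 < d by rewrite lt_min !subr_gt0 rz iz.
apply: filterS (nbhs_box z d0) => w /= [].
rewrite !lt_min => /andP[+ _] /andP[_ +]; rewrite !ltrBrDr => h1 h2.
split; [apply: le_lt_trans h1|apply: le_lt_trans h2].
- by rewrite -[X in `|X|](subrKA (complex.Re (z : R[i]))) ler_normD.
- by rewrite -[X in `|X|](subrKA (complex.Im (z : R[i]))) ler_normD.
Qed.

Lemma box_basis (z : circle R) (A : set (circle R)) : nbhs z A ->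
  exists2 c, box c z & box c `<=` A.
Proof.
rewrite nbhsE/= => -[_ [[B oB <-] /= Bz] BA].
have /nbhsCP[e e0 eB] : nbhs (set_val z) B by exact: open_nbhs_nbhs.
have [n ne] : exists n : nat, n.+1%:R^-1 < e / 2.
  have [n _ /(_ n (leqnn n))] := near_infty_natSinv_lt (PosNum (divr_gt0 e0 (ltr0n R 2))).
  by exists n.
have rat_near (x : R) : exists q : rat, `|x - ratr q| < n.+1%:R^-1.
  have /rat_in_itvoo[q] : x - n.+1%:R^-1 < x + n.+1%:R^-1.
    by rewrite ltrD2l gtrN.
  by rewrite in_itv/= -ltr_distlC; exists q.
have [p zp] := rat_near (complex.Re (circle_val z)).
have [q zq] := rat_near (complex.Im (circle_val z)).
exists (p, q, n) => //= w [/= wp wq]; apply/BA/eB.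
- rewrite -(subrKA (ratr p)) (le_lt_trans (ler_normD _ _))// [e]splitr.
  by rewrite ltrD// ?(distrC (ratr p)); apply: lt_trans ne.
- rewrite -(subrKA (ratr q)) (le_lt_trans (ler_normD _ _))// [e]splitr.
  by rewrite ltrD// ?(distrC (ratr q)); apply: lt_trans ne.
Qed.

Lemma continuous_expi : continuous (@expi R).
Proof.
move=> t A; rewrite nbhsE/= => -[_ [[B oB <-] /= Bt] BA].
have /nbhsCP[e e0 eB] : nbhs (set_val (expi t)) B by exact: open_nbhs_nbhs.
have c1 : {for t, continuous (fun s : R => cos (2 * pi * s))}.
  apply: continuous_comp; last exact: continuous_cos.
  exact: mulrl_continuous.
have c2 : {for t, continuous (fun s : R => sin (2 * pi * s))}.
  apply: continuous_comp; last exact: continuous_sin.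
  exact: mulrl_continuous.
suff : \forall s \near t, A (expi s) by [].
have /cvgr_distC_lt/(_ e e0) h1 := c1; have /cvgr_distC_lt/(_ e e0) h2 := c2.
by near=> s; apply/BA/eB => /=; near: s.
Unshelve. all: by end_near. Qed.

Lemma measurable_expi :
  measurable_fun [set: measurableTypeR R] (@expi R : _ -> borel (circle R)).
Proof.
apply: (@measurability _ _ _ (borel (circle R)) _ _ open erefl) => _ [B oB <-]; rewrite setTI.
by apply: open_measurable; move/continuousP : continuous_expi; exact.
Qed.

HB.instance Definition _ :=
  isMeasurableFun.Build _ _ _ _ (@expi R : measurableTypeR R -> borel (circle R))
    measurable_expi.

(* As the circle is second countable, the Borel sigma-algebra of [Y * circle R]
   is the product of the Borel sigma-algebras, even if [Y] is not metrizable: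
   the product measure is thus already defined on all Borel sets, and it is the
   Radon product measure when both factors are Radon. *)
Definition borel_prod (Y : ptopologicalType) :
    borel Y * borel (circle R) -> borel (Y * circle R)%type :=
  idfun.

Lemma measurable_borel_prod (Y : ptopologicalType) :
  measurable_fun setT (@borel_prod Y).
Proof.
apply: (@measurability _ _ _ (borel (Y * circle R)%type) _ _ open erefl) => _ [U oU <-]; rewrite setTI.
pose W c := \bigcup_(V in [set V : set Y | open V /\ V `*` box c `<=` U]) V.
suff -> : @borel_prod Y @^-1` U = \bigcup_c (W c `*` box c).
  apply: countable_bigcupT_measurable; first exact: countableP.
  move=> c; apply: measurableX; apply: sub_sigma_algebra.
    by apply: bigcup_open => V [].
  exact: open_box.
apply/seteqP; split=> [[y z] Uyz|[y z] [c _ [/= [V [_ VU] Vy] cz]]]; last exact: VU.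
have : nbhs ((y, z) : Y * circle R) U by exact: open_nbhs_nbhs.
move=> [[/= P Q] [/= yP zQ] PQU].
have [c cz cQ] := box_basis zQ; exists c => //; split=> //=.
move: yP; rewrite nbhsE => -[V [oV Vy] VP]; exists V => //; split=> //.
by move=> [y' z'] [/= Vy' cz']; apply: PQU; split=> /=; [exact: VP|exact: cQ].
Qed.

HB.instance Definition _ (Y : ptopologicalType) :=
  isMeasurableFun.Build _ _ _ _ (@borel_prod Y) (@measurable_borel_prod Y).

End circle_topology.

(* The image of Lebesgue measure on [0, 1] under t |-> exp(2 i pi t). *)
Definition haar_circle (R : realType) : probability (borel (circle R)) R :=
  distribution (uniform_prob (@ltr01 R)) (@expi R).

Definition times_haar (R : realType) (Y : ptopologicalType)
    (P : probability (borel Y) R) : probability (borel (Y * circle R)%type) R :=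
  distribution (P \x haar_circle R)%E (@borel_prod R Y).

Lemma times_haarX (R : realType) (Y : ptopologicalType)
    (P : probability (borel Y) R) (A : set (borel Y))
    (B : set (borel (circle R))) : measurable A -> measurable B ->
  times_haar P (A `*` B) = (P A * haar_circle R B)%E.
Proof. exact: product_measure1E. Qed.

Section dynamics.
Variables (R : realType) (Y : ptopologicalType).
Implicit Types (P : probability (borel Y) R) (S : Y -> Y).

Definition homeomorphism S := continuous S /\
  exists S' : Y -> Y, [/\ continuous S', cancel S S' & cancel S' S].

(* Inner regularity is all that is left to require of a probability measure;
   compact subsets of a Hausdorff space are closed, hence Borel. *)
Definition radon P := forall A : set (borel Y), measurable A ->
  P A = ereal_sup [set P K | K in [set K : set Y | compact K /\ K `<=` A]].

Definition preserves S P :=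
  forall A : set (borel Y), measurable A -> P (S @^-1` A) = P A.

Definition ergodic P S := preserves S P /\
  forall A : set (borel Y), measurable A -> S @^-1` A = A ->
    P A = 0%E \/ P A = 1%E.

(* Measures are compared on measurable sets only: their values elsewhere are
   arbitrary. *)
Definition uniquely_ergodic S := exists P,
  [/\ radon P, preserves S P &
    forall Q : probability (borel Y) R, radon Q -> preserves S Q ->
      forall A : set (borel Y), measurable A -> Q A = P A].

(* Representatives of the elements of the complex space L^oo(Y, P). *)
Definition Linfty P (g : Y -> R[i]) :=
  measurable_fun [set: borel Y] (g : _ -> borel R[i]^o) /\
  exists M : R, {ae P, forall y, `|g y| <= M%:C}.

End dynamics.

Definition skew_product (R : realType) (Y : Type) (S : Y -> Y)
    (f : Y -> circle R) (x : Y * circle R) : Y * circle R :=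
  (S x.1, circle_mul (f x.1) x.2).

(* Main.v *)
(* (i) <-> (ii): if [A] is [T]-invariant, its fibrewise Fourier coefficients
   g_k(x) = \int 1_A(x, z) z^-k dz solve the equation of (ii) with n = k.  If
   they vanish for all k > 0, almost every fibre A_x is null or conull, and the
   ergodicity of [mu_o] concludes.  Conversely a solution g makes g(x) z^n an
   invariant function that changes sign under a rotation, hence is null.

   (iii) -> (i): conditioning [mu] on an invariant set gives another invariant
   Radon measure.

   (i) -> (iii): let nu be invariant and Radon.  Its marginal is [mu_o], so its
   average over all rotations of the circle is [mu].  Its average over the
   rotations in a neighbourhood W of 1 is invariant and dominated by a multiple
   of [mu], hence equal to [mu] by ergodicity; letting W shrink to 1 gives
   nu = [mu].  No pointwise ergodic theorem, hence no separability, is needed. *)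
Require Import Defs.
From HB Require Import structures.
From mathcomp Require Import all_boot all_order all_algebra complex.
From mathcomp Require Import all_classical all_reals all_analysis.
From mathcomp Require Import measurable_realfun ring lra.

Set Implicit Arguments.
Unset Strict Implicit.
Unset Printing Implicit Defensive.

Import Order.TTheory GRing.Theory Num.Theory numFieldNormedType.Exports.

Local Open Scope classical_set_scope.
Local Open Scope ring_scope.

(** As [X_o] may fail to be metrizable, two points need care. Product measures live on the product
    of the Borel sigma-algebras, so that joint measurability has to be checked there; this is what
    [borel_prodP] and [borel_prodZP] provide. And every measure that is constructed must be shown to
    be inner regular, which is done through [tight] sets, stable under countable operations.

    [ergodic] concerns strictly invariant sets, while a solution of the equation in (ii) yields sets
    that are invariant almost everywhere only; a limsup set bridges the gap.

    That an invariant measure dominated by an ergodic one is equal to it is read off a Hahn set of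
    their difference, saturated by orbits.

    That a set with vanishing Fourier coefficients is null or conull comes from the powers of (1 +
    Re z) / 2: they are trigonometric polynomials, so their convolution with the indicator is
    constant, but they concentrate at 1, so it should also be close to the indicator itself. Inner
    regularity of Haar measure makes this a contradiction unless the set is trivial. *)

Lemma complex_ReM (R : realType) (z w : R[i]) :
  complex.Re (z * w) =
  complex.Re z * complex.Re w - complex.Im z * complex.Im w.
Proof. by case: z w => [a b] [c d]. Qed.

Lemma complex_ImM (R : realType) (z w : R[i]) :
  complex.Im (z * w) =
  complex.Re z * complex.Im w + complex.Im z * complex.Re w.
Proof. by case: z w => [a b] [c d]. Qed.

(** * The circle as a topological group, and Borel measurability of continuous maps *)

Section borel_circle.
Variable R : realType.
Implicit Types z w : circle R.
Local Notation re z := (complex.Re (circle_val z)).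
Local Notation im z := (complex.Im (circle_val z)).

Lemma circle_val_inj : injective (@circle_val R).
Proof. exact: val_inj. Qed.

Lemma circle_sqr z : re z ^+ 2 + im z ^+ 2 = 1.
Proof.
apply: complexI; rewrite add_Re2_Im2 circle_norm expr1n//.
Qed.

Lemma circle_valM z w :
  circle_val (circle_mul z w) = circle_val z * circle_val w.
Proof. by []. Qed.

Lemma circle_mulA z w v :
  circle_mul z (circle_mul w v) = circle_mul (circle_mul z w) v.
Proof. by apply: circle_val_inj; rewrite !circle_valM mulrA. Qed.

Lemma circle_mulC z w : circle_mul z w = circle_mul w z.
Proof. by apply: circle_val_inj; rewrite !circle_valM mulrC. Qed.

Lemma circle_conj_subproof z : `|(circle_val z)^*%C| = 1.
Proof. by rewrite normcJ circle_norm. Qed.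

(** The group inverse, given as conjugation so that its real coordinates are visibly continuous. *)
Definition circle_conj z : circle R := Circle (circle_conj_subproof z).

Lemma circle_mulV z : circle_val z * circle_val (circle_conj z) = 1.
Proof. by rewrite /= -sqr_normc circle_norm expr1n. Qed.

Lemma circle_conjE z : circle_val (circle_conj z) = (circle_val z)^-1.
Proof.
rewrite -[LHS]mul1r -(mulVf (x := circle_val z)) ?mulrVK//.
  by rewrite -mulrA circle_mulV mulr1.
by rewrite -normr_eq0 circle_norm oner_eq0.
Qed.

Lemma circle_mulKV z : cancel (circle_mul z) (circle_mul (circle_conj z)).
Proof.
move=> w; apply: circle_val_inj.
by rewrite !circle_valM mulrA [X in X * _]mulrC circle_mulV mul1r.
Qed.

Lemma circle_mulVK z : cancel (circle_mul (circle_conj z)) (circle_mul z).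
Proof.
move=> w; apply: circle_val_inj.
by rewrite !circle_valM mulrA circle_mulV mul1r.
Qed.

Lemma continuous_circle_re : continuous (fun z : circle R => re z).
Proof.
move=> z; apply: (@continuous_comp _ _ _ (@set_val _ _ : circle R -> R[i]^o)
    (fun u : R[i]^o => complex.Re (u : R[i]))).
  exact: initial_continuous.
apply/(@cvgrPdist_lt _ _ _ _ (nbhs_filter (set_val z : R[i]^o))) => e e0.
apply: (@filterS _ _ (nbhs_filter (set_val z : R[i]^o)) _ _ _ (nbhs_box _ e0)).
by move=> u /= [+ _]; rewrite distrC.
Qed.

Lemma continuous_circle_im : continuous (fun z : circle R => im z).
Proof.
move=> z; apply: (@continuous_comp _ _ _ (@set_val _ _ : circle R -> R[i]^o)
    (fun u : R[i]^o => complex.Im (u : R[i]))).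
  exact: initial_continuous.
apply/(@cvgrPdist_lt _ _ _ _ (nbhs_filter (set_val z : R[i]^o))) => e e0.
apply: (@filterS _ _ (nbhs_filter (set_val z : R[i]^o)) _ _ _ (nbhs_box _ e0)).
by move=> u /= [_]; rewrite distrC.
Qed.

(** The circle has the topology induced from the plane, where every neighbourhood contains a
    coordinate box. *)
Lemma continuous_circle (Y : topologicalType) (h : Y -> circle R) :
  continuous (fun y => re (h y)) -> continuous (fun y => im (h y)) ->
  continuous h.
Proof.
move=> c1 c2 y A; rewrite nbhsE/= => -[_ [[B oB <-] /= By] BA].
have /nbhsCP[e e0 eB] : nbhs (set_val (h y)) B by exact: open_nbhs_nbhs.
suff : \forall s \near y, A (h s) by [].
have /cvgr_distC_lt/(_ e e0) h1 := c1 y.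
have /cvgr_distC_lt/(_ e e0) h2 := c2 y.
by near=> s; apply/BA/eB => /=; near: s.
Unshelve. all: by end_near. Qed.

Lemma continuous_circle_mul (Y : topologicalType) (g h : Y -> circle R) :
  continuous g -> continuous h -> continuous (fun y => circle_mul (g y) (h y)).
Proof.
move=> cg ch.
have cre (u : Y -> circle R) : continuous u -> continuous (fun y : Y => re (u y)).
  by move=> cu y; exact: continuous_comp (cu y) (@continuous_circle_re (u y)).
have cim (u : Y -> circle R) : continuous u -> continuous (fun y : Y => im (u y)).
  by move=> cu y; exact: continuous_comp (cu y) (@continuous_circle_im (u y)).
apply: continuous_circle => y.
  under eq_fun do rewrite circle_valM complex_ReM.
  by apply: cvgB; apply: cvgM; [exact: cre|exact: cre|exact: cim|exact: cim].
under eq_fun do rewrite circle_valM complex_ImM.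
by apply: cvgD; apply: cvgM; [exact: cre|exact: cim|exact: cim|exact: cre].
Qed.

Lemma continuous_borel (Y Z : ptopologicalType) (h : Y -> Z) :
  continuous h -> measurable_fun [set: borel Y] (h : _ -> borel Z).
Proof.
move=> ch.
apply: (@measurability _ _ _ (borel Z) _ _ open erefl) => _ [U oU <-].
by rewrite setTI; apply: sub_sigma_algebra; move/continuousP : ch; exact.
Qed.

Lemma open_borel (Y : ptopologicalType) (U : set Y) :
  open U -> measurable (U : set (borel Y)).
Proof. exact: sub_sigma_algebra. Qed.

Lemma closed_borel (Y : ptopologicalType) (U : set Y) :
  closed U -> measurable (U : set (borel Y)).
Proof.
move=> cU; rewrite -[U]setCK; apply: (@measurableC _ (borel Y)).
by apply: open_borel; exact: closed_openC.
Qed.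

Lemma continuous_borelR (Y : ptopologicalType) (h : Y -> R) :
  continuous h -> measurable_fun [set: borel Y] h.
Proof.
move=> /continuousP ch; apply: (measurability _ (RGenOpens.measurableE R)).
move=> _ [_ [a [b ->] <-]]; rewrite setTI.
by apply: open_borel; apply: ch; exact: interval_open.
Qed.
End borel_circle.

(** * Haar measure on the circle *)

(** The image measure under the translation gives []a, b]] the length of []a - s, b - s]], and
    Lebesgue measure is determined by such intervals. *)
Lemma lebesgue_measure_translation (R : realType) (s : R)
    (A : set (measurableTypeR R)) :
  measurable A ->
  lebesgue_measure ((fun t => s + t) @^-1` A) = lebesgue_measure A.
Proof.
have ms : measurable_fun [set: measurableTypeR R]
    ((fun t => s + t) : _ -> measurableTypeR R) by exact: measurable_funD.
pose smix := isMeasurableFun.Build _ _ _ _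
  ((fun t => s + t) : measurableTypeR R -> measurableTypeR R) ms.
pose h : {mfun measurableTypeR R >-> measurableTypeR R} :=
  HB.pack (fun t => s + t) smix.
pose p : {measure set (measurableTypeR R) -> \bar R} :=
  pushforward lebesgue_measure h.
move=> mA; apply/esym; apply: (@lebesgue_measure_unique R (p ms)) => //.
move=> _ [[a b] _ <-]; rewrite /p/= /pushforward.
rewrite (_ : _ @^-1` _ = `](a - s), (b - s)]%classic); last first.
  apply/seteqP; split=> t /=; rewrite !in_itv/=.
    by move=> /andP[? ?]; apply/andP; split; lra.
  by move=> /andP[? ?]; apply/andP; split; lra.
rewrite !lebesgue_measure_itv/= !lte_fin ltrD2r; case: ifP => // _.
by rewrite -!EFinB; congr (_%:E); ring.
Qed.

Section haar.
Variable R : realType.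
Implicit Types z w : circle R.

Lemma circle_val_expi (t : R) :
  circle_val (expi t) = (cos (2 * pi * t) +i* sin (2 * pi * t))%C.
Proof. by []. Qed.

Lemma expiD (s t : R) : expi (s + t) = circle_mul (expi s) (expi t).
Proof.
apply: circle_val_inj; rewrite circle_valM !circle_val_expi.
by apply/eqP; rewrite eq_complex/= mulrDr cosD sinD !eqxx/= [X in _ == X]addrC.
Qed.

Lemma expi1 : expi (1 : R) = expi 0.
Proof.
apply: circle_val_inj; rewrite !circle_val_expi.
by rewrite mulr1 mulr0 cos0 sin0 mulrC mulr_natr cos2pi sin2pi.
Qed.

Lemma expiD1 (t : R) : expi (t + 1) = expi t.
Proof. by rewrite expiD expi1 -expiD addr0. Qed.

Lemma expi_surj z : exists2 t : R, 0 <= t <= 1 & expi t = z.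
Proof.
have [a [b zE]] : exists a b, circle_val z = (a +i* b)%C.
  by case: (circle_val z) => a b; exists a, b.
have := circle_sqr z; rewrite zE/= => ab1.
have a11 : -1 <= a <= 1.
  by rewrite -ler_norml -(expr_le1 (n := 2))// real_normK ?num_real//; nra.
have pi0 : pi != 0 :> R by rewrite gt_eqF// pi_gt0.
have sE : sin (acos a) = `|b|.
  by rewrite sin_acos// -sqrtr_sqr; congr Num.sqrt; rewrite -ab1 addrC addKr.
have ca : cos (acos a) = a by rewrite acosK// in_itv.
have tE t : 2 * pi * (t / (2 * pi)) = t :> R.
  by rewrite mulrC divfK// mulf_neq0.
(* [u] lies in [0, 1/2] and parametrizes the upper half circle; for [b < 0] the angle is [- u],
   brought back to [0, 1] by the period. *)
pose u := acos a / (2 * pi).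
have pi20 : 0 < 2 * pi :> R by rewrite mulr_gt0// pi_gt0.
have u0 : 0 <= u by rewrite divr_ge0 ?acos_ge0// ltW.
have u1 : u <= 1.
  rewrite ler_pdivrMr// mul1r (le_trans (acos_lepi a11))// ler_peMl ?ler1n//.
  exact: pi_ge0.
have [b0|b0] := leP 0 b.
  exists u; first by rewrite u0.
  by apply: circle_val_inj; rewrite zE circle_val_expi tE ca sE ger0_norm.
exists (- u + 1); first by apply/andP; split; lra.
apply: circle_val_inj; rewrite expiD1 zE circle_val_expi mulrN tE.
by rewrite cosN sinN ca sE ltr0_norm// opprK.
Qed.

Lemma measurable_preimage_expi (A : set (circle R)) :
  measurable (A : set (borel _)) ->
  measurable ((@expi R) @^-1` A : set (measurableTypeR R)).
Proof.
by move=> mA; rewrite -[X in measurable X]setTI; exact: measurable_expi.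
Qed.

Lemma haar_circleE (A : set (circle R)) : measurable (A : set (borel _)) ->
  haar_circle R A = lebesgue_measure ((@expi R) @^-1` A `&` `]0, 1]).
Proof.
move=> mA; rewrite /haar_circle /distribution /pushforward/= /uniform_prob.
have mEA := measurable_preimage_expi mA.
rewrite integral_uniform_pdf.
rewrite (eq_integral (fun=> 1%:E)); last first.
  move=> t; rewrite inE/= /uniform_pdf => -[_]; rewrite in_itv/= => ->.
  by rewrite subr0 invr1.
rewrite integral_cst ?mul1e//; last exact: measurableI.
(* Dropping the null point [0] leaves []0, 1]], which meets each orbit of translation by 1 exactly
   once. *)
rewrite -(@setU1itv _ _ _ _ false) ?bnd_simp// setIUr measureU//.
- rewrite [X in (X + _)%E](_ : _ = 0%E) ?add0e//.
  apply/eqP; rewrite -measure_le0 -(lebesgue_measure_set1 (0 : R)).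
  by apply: le_measure => //; rewrite inE//; exact: measurableI.
- exact: measurableI.
- exact: measurableI.
- apply/seteqP; split=> // t /= [[_ ->] [_]].
  by rewrite in_itv/= ltxx.
Qed.

Lemma measurable_circle_mulr w :
  measurable_fun [set: borel (circle R)] (circle_mul w : _ -> borel (circle R)).
Proof.
apply: continuous_borel; apply: continuous_circle_mul; last by move=> ?.
by move=> ?; exact: cst_continuous.
Qed.

Lemma measurable_preimage_rot w (A : set (circle R)) :
  measurable (A : set (borel _)) ->
  measurable (circle_mul w @^-1` A : set (borel (circle R))).
Proof.
by move=> mA; rewrite -[X in measurable X]setTI; exact: measurable_circle_mulr.
Qed.

(** Rotation by [expi s] turns the window []0, 1]] into []s, s + 1]]. Both are cut, at [s] and at 1:
    []s, 1]] is common, and the period carries []0, s]] onto []1, s + 1]]. *)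
Lemma haar_circle_rot w (A : set (circle R)) : measurable (A : set (borel _)) ->
  haar_circle R (circle_mul w @^-1` A) = haar_circle R A.
Proof.
wlog [s [s0 s1 ->]] : w / exists s, [/\ 0 <= s, s <= 1 & w = expi s].
  move=> rotE mA; have [t /andP[t0 t1] <-] := expi_surj w.
  by apply: rotE => //; exists t.
move=> mA; rewrite !haar_circleE//; last exact: measurable_preimage_rot.
set B := @expi R @^-1` A; have mB : measurable B := measurable_preimage_expi mA.
have msplit (a b c : R) : a <= b -> b <= c -> lebesgue_measure (B `&` `]a, c]) =
    (lebesgue_measure (B `&` `]a, b]) + lebesgue_measure (B `&` `]b, c]))%E.
  move=> ab bc; rewrite (@itv_bndbnd_setU _ _ _ (BRight b)) ?bnd_simp//.
  rewrite setIUr measureU//; [exact: measurableI|exact: measurableI|].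
  apply/seteqP; split=> // t /= [[_ +] [_]].
  by rewrite !in_itv/= => /andP[_ tb] /andP[]; rewrite ltNge tb.
rewrite (_ : _ `&` _ = (fun t => s + t) @^-1` (B `&` `]s, s + 1])); last first.
  apply/seteqP; split=> t /=; rewrite /B /= !in_itv/= expiD ltrDl lerD2l//.
rewrite lebesgue_measure_translation; last exact: measurableI.
rewrite (msplit _ 1)// ?lerDr// [RHS](msplit _ s)// addeC; congr (_ + _)%E.
rewrite -(@lebesgue_measure_translation _ 1); last exact: measurableI.
congr lebesgue_measure; apply/seteqP; split=> t /=; rewrite !in_itv/=.
  by rewrite /B/= addrC expiD1 => -[? /andP[? ?]]; split => //; lra.
by rewrite /B/= addrC expiD1 => -[? /andP[? ?]]; split => //; lra.
Qed.
End haar.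

(** * Tightness and Radon product measures *)

Section topology.
Variable R : realType.

(** [hausdorff_space] says that a cluster point of [nbhs p] is [p]; hence a family of continuous
    maps into Hausdorff spaces that separates points makes the source Hausdorff. *)
Lemma cluster_continuous (Y Z : topologicalType) (h : Y -> Z) (p q : Y) :
  hausdorff_space Z -> continuous h -> cluster (nbhs p) q -> h p = h q.
Proof.
move=> hZ ch pq; apply: hZ => A B /ch hA /ch hB.
by have [y [? ?]] := pq _ _ hA hB; exists (h y).
Qed.

Lemma hausdorff_circle : hausdorff_space (circle R).
Proof.
move=> z w zw; apply: circle_val_inj.
have := cluster_continuous (@Rhausdorff R) (@continuous_circle_re R) zw.
have := cluster_continuous (@Rhausdorff R) (@continuous_circle_im R) zw.
by move=> /= imE reE; apply/eqP; rewrite eq_complex reE imE !eqxx.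
Qed.

Lemma compact_circle : compact [set: circle R].
Proof.
rewrite (_ : setT = (@expi R) @` `[0, 1]); last first.
  apply/seteqP; split=> // z _; have [t t01 <-] := expi_surj z.
  by exists t => //=; rewrite in_itv.
apply: continuous_compact; last exact: segment_compact.
by apply: continuous_subspaceT; exact: continuous_expi.
Qed.

Lemma hausdorff_prod (Y Z : topologicalType) : hausdorff_space Y ->
  hausdorff_space Z -> hausdorff_space (Y * Z)%type.
Proof.
move=> hY hZ [y z] [y' z'] yz.
have := cluster_continuous hY (fun p => @cvg_fst _ _ _ _ _) yz.
have := cluster_continuous hZ (fun p => @cvg_snd _ _ _ _ _) yz.
by move=> /= -> ->.
Qed.

End topology.

Section tight.
Variables (R : realType) (Y : ptopologicalType).
Hypothesis hY : hausdorff_space Y.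
Variable P : probability (borel Y) R.

(** Inner regularity of a single set with an additive error, a form in which the errors of countably
    many sets can be summed. *)
Definition tight (A : set Y) := forall e : R, 0 < e ->
  exists K : set Y, [/\ compact K, K `<=` A & (P (A `\` K) < e%:E)%E].

Lemma compact_borel (K : set Y) : compact K -> measurable (K : set (borel Y)).
Proof. by move=> cK; apply: closed_borel; exact: compact_closed. Qed.

Lemma radonP : radon P <-> forall A : set (borel Y), measurable A -> tight A.
Proof.
split=> [rP A mA e e0|tP A mA].
  have /(ub_ereal_sup_adherent e0) :
      ereal_sup [set P K | K in [set K : set Y | compact K /\ K `<=` A]]
      \is a fin_num by rewrite -rP// fin_num_measure.
  rewrite -rP// => -[_ [K [cK KA] <-]] PK; exists K; split=> //.
  have mK := compact_borel cK.
  rewrite measureD//; last by rewrite ltey_eq fin_num_measure.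
  rewrite setIidr// lteBlDl ?fin_num_measure//.
  by rewrite lteBlDr// addeC in PK *; rewrite addeC.
apply/eqP; rewrite eq_le; apply/andP; split.
  apply/lee_addgt0Pr => e e0; have [K [cK KA PK]] := tP _ mA _ e0.
  have mK := compact_borel cK.
  rewrite -(setDUK KA) (le_trans (measureU2 _ mK _))//; first exact: measurableD.
  by rewrite leeD// ?(ltW PK)//; apply: ereal_sup_ubound; exists K.
apply: ge_ereal_sup => _ [K [cK KA] <-].
by apply: le_measure => //; rewrite inE//; exact: compact_borel.
Qed.

(** Errors [e / 2 / 2 ^ n.+1] sum up to [e / 2], and a point of all [A n] outside some [K n] is
    counted by one of them. The intersection of the [K n] is closed in the compact set [K 0]. *)
Lemma tight_bigcap (A : nat -> set Y) :
  (forall n, measurable (A n : set (borel Y))) ->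
  (forall n, tight (A n)) -> tight (\bigcap_n A n).
Proof.
move=> mA tA e e0.
have /choice[K HK] n : exists K : set Y, [/\ compact K, K `<=` A n &
    (P (A n `\` K) < (e / 2 / (2 ^ n.+1)%:R)%:E)%E].
  by apply: tA; rewrite !divr_gt0// ltr0n expn_gt0.
have cK n : compact (K n) by have [] := HK n.
have mK n : measurable (K n : set (borel Y)) by exact: compact_borel.
exists (\bigcap_n K n); split.
- apply: (subclosed_compact _ (cK 0%N)); last by move=> y; exact.
  by apply: closed_bigI => n _; exact: compact_closed.
- by move=> y Ky n _; have [_ + _] := HK n; apply; exact: Ky.
- apply: (@le_lt_trans _ _ (e / 2)%:E); last by rewrite lte_fin; lra.
  apply: le_trans (@epsilon_trick0 R (e / 2) xpredT _); last by lra.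
  apply: (@le_trans _ _ (\sum_(n <oo) P (A n `\` K n))%E).
    apply: measure_sigma_subadditive.
    - by move=> n; exact: measurableD.
    - apply: measurableD; exact: bigcapT_measurable.
    - move=> y [Ay /existsNP[n /not_implyP[_ nKy]]]; exists n => //; split=> //.
      exact: Ay.
  by apply: lee_nneseries => // n _; have [_ _ /ltW] := HK n.
Qed.

(* The compact approximants sum up to an error [e / 2]; the other half pays for
   keeping only finitely many of them. *)
Lemma tight_bigcup (A : nat -> set Y) :
  (forall n, measurable (A n : set (borel Y))) ->
  (forall n, tight (A n)) -> tight (\bigcup_n A n).
Proof.
move=> mA tA e e0.
have /choice[K HK] n : exists K : set Y, [/\ compact K, K `<=` A n &
    (P (A n `\` K) < (e / 2 / (2 ^ n.+1)%:R)%:E)%E].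
  by apply: tA; rewrite !divr_gt0// ltr0n expn_gt0.
have cK n : compact (K n) by have [] := HK n.
have mK n : measurable (K n : set (borel Y)) by exact: compact_borel.
pose L n := \big[setU/set0]_(i < n) K i.
have cL n : compact (L n).
  rewrite /L; elim: n => [|n IH]; first by rewrite big_ord0; exact: compact0.
  by rewrite big_ord_recr/=; exact: compactU.
have mL n : measurable (L n : set (borel Y)) by exact: compact_borel.
have mU : measurable (\bigcup_n A n : set (borel Y)).
  exact: bigcupT_measurable.
have mUL n : measurable (\bigcup_n A n `\` L n : set (borel Y)).
  exact: measurableD.
have PUK : (P (\bigcup_n A n `\` \bigcup_n K n) < e%:E)%E.
  apply: (@le_lt_trans _ _ (e / 2)%:E); last by rewrite lte_fin; lra.
  apply: le_trans (@epsilon_trick0 R (e / 2) xpredT _); last by lra.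
  apply: (@le_trans _ _ (\sum_(n <oo) P (A n `\` K n))%E).
    apply: measure_sigma_subadditive.
    - by move=> n; exact: measurableD.
    - by apply: measurableD => //; exact: bigcupT_measurable.
    - move=> y [[n _ Ay] nKy]; exists n => //; split=> // Kny.
      by apply: nKy; exists n.
  by apply: lee_nneseries => // n _; have [_ _ /ltW] := HK n.
have capE : \bigcap_n (\bigcup_n A n `\` L n) =
    \bigcup_n A n `\` \bigcup_n K n.
  apply/seteqP; split=> [y Ly|y [Ay nKy] n _]; last first.
    split=> // Lny; apply: nKy; move: Lny; rewrite /L -bigcup_mkord.
    by move=> [i _ Kiy]; exists i.
  split; first by have [] := Ly 0%N Logic.I.
  move=> [n _ Kny]; have [_] := Ly n.+1 Logic.I; apply.
  by rewrite /L big_ord_recr; right.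
have : P \o (fun n => \bigcup_n A n `\` L n) @ \oo -->
    P (\bigcap_n (\bigcup_n A n `\` L n)).
  apply: nonincreasing_cvg_mu => //.
  - by rewrite ltey_eq fin_num_measure.
  - exact: bigcapT_measurable.
  - move=> m n mn; apply/subsetPset; apply: setDS.
    by rewrite /L; exact: subset_bigsetU.
rewrite capE => /(_ [set x | x < e%:E]%E) [].
  by apply: open_nbhs_nbhs; split => //; exact: open_ereal_lt_ereal.
move=> n _ /(_ n (leqnn n)) /= PL; exists (L n); split=> //.
rewrite /L -bigcup_mkord => y [i _ Kiy]; exists i => //.
by have [_ + _] := HK i; apply.
Qed.

(** Requiring both the set and its complement to be tight makes the class stable under complement;
    compactness of [Y] puts the whole space in it. Tightness thus has to be checked on generators
    only. *)
Lemma tight_sigma_algebra : compact [set: Y] ->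
  sigma_algebra setT
    [set A : set (borel Y) | [/\ measurable A, tight A & tight (~` A)]].
Proof.
move=> cY; split.
- split=> // e e0.
    by exists set0; split; [exact: compact0| |rewrite setD0 measure0].
  by exists setT; rewrite setC0 setDT measure0.
- move=> A [mA tA tcA]; rewrite setTD.
  by split => //; [exact: measurableC|rewrite setCK].
- move=> A HA; split.
  + by apply: bigcupT_measurable => n; have [] := HA n.
  + by apply: tight_bigcup => n; have [] := HA n.
  + rewrite setC_bigcup; apply: tight_bigcap => n; have [? ? ?] := HA n => //.
    exact: measurableC.
Qed.

End tight.

Section borel_product.
Variables (R : realType) (Y Z : ptopologicalType).
Local Notation X := (Y * Z)%type.
Implicit Types (A : set Y) (B : set Z) (D : set X).

Lemma measurable_fst_borel :
  measurable_fun [set: borel X] (fst : _ -> borel Y).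
Proof. by apply: continuous_borel => p; exact: cvg_fst. Qed.

Lemma measurable_snd_borel :
  measurable_fun [set: borel X] (snd : _ -> borel Z).
Proof. by apply: continuous_borel => p; exact: cvg_snd. Qed.

Lemma measurable_borel_setX A B :
  measurable (A : set (borel Y)) -> measurable (B : set (borel Z)) ->
  measurable (A `*` B : set (borel X)).
Proof.
move=> mA mB; have m1 := measurable_fst_borel measurableT mA.
have m2 := measurable_snd_borel measurableT mB.
by rewrite setTI in m1; rewrite setTI in m2; exact: measurableI m1 m2.
Qed.

Hypothesis borel_prodP : forall D,
  measurable (D : set (borel X)) -> measurable (D : set (borel Y * borel Z)).
Variables (P1 : probability (borel Y) R) (P2 : probability (borel Z) R).
Variable P : probability (borel X) R.
Hypothesis PE : forall A B,
  measurable (A : set (borel Y)) -> measurable (B : set (borel Z)) ->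
  P (A `*` B) = (P1 A * P2 B)%E.
Hypotheses (hY : hausdorff_space Y) (hZ : hausdorff_space Z).
Hypotheses (rP1 : radon P1) (rP2 : radon P2).

(** What the product of the compact approximants misses lies over [A] minus [K] or over [B] minus
    [L], two strips of measure less than [e / 2]. *)
Lemma tight_setX A B :
  measurable (A : set (borel Y)) -> measurable (B : set (borel Z)) ->
  tight P (A `*` B).
Proof.
move=> mA mB e e0; have e20 : 0 < e / 2 by rewrite divr_gt0.
have [K [cK KA PK]] := (radonP hY P1).1 rP1 _ mA _ e20.
have [L [cL LB PL]] := (radonP hZ P2).1 rP2 _ mB _ e20.
have mK := compact_borel hY cK; have mL := compact_borel hZ cL.
exists (K `*` L); split; first exact: compact_setX.
  by move=> [y z] [/KA ? /LB ?].
have mAK : measurable (A `\` K : set (borel Y)) by exact: measurableD.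
have mBL : measurable (B `\` L : set (borel Z)) by exact: measurableD.
have m1 : measurable ((A `\` K) `*` setT : set (borel X)).
  exact: measurable_borel_setX.
have m2 : measurable (setT `*` (B `\` L) : set (borel X)).
  exact: measurable_borel_setX.
apply: (@le_lt_trans _ _ (P ((A `\` K) `*` setT `|` setT `*` (B `\` L)))).
  apply: le_measure; rewrite ?inE.
  - by apply: measurableD; exact: measurable_borel_setX.
  - exact: measurableU.
  - move=> [y z] [[/= Ay Bz] nKL].
    have [Ky|nKy] := pselect (K y); last by left.
    by right; split=> //; split=> // Lz; apply: nKL.
rewrite (le_lt_trans (measureU2 _ m1 m2))// [e]splitr EFinD lteD//.
- rewrite [ltLHS](PE mAK measurableT).
  by rewrite probability_setT mule1.
- rewrite [ltLHS](PE measurableT mBL).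
  by rewrite probability_setT mul1e.
Qed.

(** Rectangles generate the product sigma-algebra, which contains all Borel sets by [borel_prodP],
    and the complement of a rectangle is a union of two rectangles. *)
Lemma radon_product : compact [set: X] -> radon P.
Proof.
move=> cX; have hX := hausdorff_prod hY hZ.
have := tight_sigma_algebra hX P cX.
set G := [set A : set (borel _) | _] => sG.
suff mG D : measurable (D : set (borel Y * borel Z)) -> G D.
  by apply/(radonP hX) => D mD; have [] := mG _ (borel_prodP mD).
rewrite measurable_prod_measurableType; apply.
split=> // _ [A mA [B mB <-]].
have mAC : measurable (~` A : set (borel Y)) by exact: measurableC.
have mBC : measurable (~` B : set (borel Z)) by exact: measurableC.
split; [exact: measurable_borel_setX|exact: tight_setX|].
rewrite (_ : ~` _ = ~` A `*` setT `|` setT `*` ~` B); last first.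
  apply/seteqP; split=> [[y z] nAB|[y z] [[+ _]|[_ +]]] /=.
  - have [Ay|] := pselect (A y); last by left.
    by right; split=> // Bz; apply: nAB.
  - by move=> nA [].
  - by move=> nB [].
(* The union of two sets is a countable union padded with empty sets. *)
rewrite -bigcup2E; apply: tight_bigcup => //.
- move=> [|[|n]]/=; last exact: measurable0.
    exact: measurable_borel_setX.
  exact: measurable_borel_setX.
- move=> [|[|n]]/=; [exact: tight_setX|exact: tight_setX|].
  by move=> e e0; exists set0; split; [exact: compact0| |rewrite setD0 measure0].
Qed.

End borel_product.

(** * Compact group extensions *)

Section invariance.
Variable R : realType.

Lemma ge0_integral_preserves (Y : ptopologicalType) (S : Y -> Y)
    (P : probability (borel Y) R) (h : Y -> \bar R) :
  measurable_fun [set: borel Y] (S : _ -> borel Y) -> preserves S P ->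
  measurable_fun [set: borel Y] h -> (forall y, 0 <= h y)%E ->
  (\int[P]_y h (S y) = \int[P]_y h y)%E.
Proof.
move=> mS SP mh h0.
have /esym := @ge0_integral_pushforward _ _ (borel Y) (borel Y) R S mS P setT h
  measurableT mh (fun y _ => h0 y).
rewrite preimage_setT => ->.
by apply: eq_measure_integral => A mA _; exact: SP.
Qed.

Lemma measurable_preimage_borel (Y Z : ptopologicalType) (h : Y -> Z) A :
  continuous h -> measurable (A : set (borel Z)) ->
  measurable (h @^-1` A : set (borel Y)).
Proof.
by move=> ch mA; rewrite -[X in measurable X]setTI; exact: continuous_borel.
Qed.

End invariance.

Section group_extension.
Variables (R : realType) (Y Z : ptopologicalType).
Local Notation X := (Y * Z)%type.
Variables (mul : Z -> Z -> Z).
Hypothesis mulA : associative mul.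
Hypothesis mulC : commutative mul.
Hypothesis mul_cont : continuous (fun p : Z * Z => mul p.1 p.2).
Hypothesis borel_prodP : forall D : set X,
  measurable (D : set (borel X)) -> measurable (D : set (borel Y * borel Z)).
Hypothesis borel_prodZP : forall D : set (Z * Z),
  measurable (D : set (borel (Z * Z)%type)) ->
  measurable (D : set (borel Z * borel Z)).

(** Measurability is claimed for the product sigma-algebra, on which product measures are defined,
    so continuity of the map does not suffice: the map is decomposed into coordinates, and Borel
    sets of [Z * Z] and of [X] are taken back to product sigma-algebras. *)
Lemma measurable_rot : measurable_fun [set: borel X * borel Z]
  ((fun p => (p.1.1, mul p.2 p.1.2)) : _ -> borel X).
Proof.
have m11 : measurable_fun [set: borel X * borel Z]
    ((fun p => p.1.1) : _ -> borel Y).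
  exact: (measurableT_comp (@measurable_fst_borel Y Z)).
have m12 : measurable_fun [set: borel X * borel Z]
    ((fun p => p.1.2) : _ -> borel Z).
  exact: (measurableT_comp (@measurable_snd_borel Y Z)).
have mm : measurable_fun [set: borel Z * borel Z]
    ((fun p => mul p.1 p.2) : _ -> borel Z).
  move=> _ A mA; rewrite setTI; apply: borel_prodZP.
  exact: (measurable_preimage_borel mul_cont).
have m2 : measurable_fun [set: borel X * borel Z]
    ((fun p => mul p.2 p.1.2) : _ -> borel Z).
  move=> _ A mA; have := mm measurableT _ mA; rewrite setTI => mA'.
  have := measurable_fun_pair measurable_snd m12 measurableT mA'.
  by rewrite setTI.
move=> _ A mA; rewrite setTI.
have := measurable_fun_pair m11 m2 measurableT (borel_prodP mA).
by rewrite setTI.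
Qed.

Lemma measurable_fiber (th : probability (borel Z) R) (A : set X) :
  measurable (A : set (borel X)) ->
  measurable_fun [set: borel Y] (fun y => th [set z | A (y, z)]).
Proof.
move=> mA; have := measurable_fun_xsection th (borel_prodP mA).
apply: eq_measurable_fun => y _ /=; congr (th _).
by apply/seteqP; split=> z; rewrite /xsection/= inE.
Qed.

Lemma measurable_fiber_rot (th : probability (borel Z) R) (A : set X) :
  measurable (A : set (borel X)) ->
  measurable_fun [set: borel X] (fun x => th [set w | A (x.1, mul w x.2)]).
Proof.
move=> mA; have := measurable_rot measurableT mA; rewrite setTI => mA'.
have := measurable_fun_xsection th mA'.
apply: eq_measurable_fun => y _ /=; congr (th _).
by apply/seteqP; split=> z; rewrite /xsection/= inE.
Qed.

Lemma measurable_section (A : set X) (y : Y) :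
  measurable (A : set (borel X)) ->
  measurable ([set z | A (y, z)] : set (borel Z)).
Proof.
move=> mA; rewrite (_ : mkset _ = xsection (A : set (borel Y * borel Z)) y).
  by apply: measurable_xsection; exact: borel_prodP.
by apply/seteqP; split=> z; rewrite /xsection/= inE.
Qed.

(** [Q] is the average of the copies of [nu] rotated by [w], with weight [th] on [w]: the image of
    the product of [nu] and [th] under the action. *)
Lemma fiber_convolution (nu : probability (borel X) R)
    (th : probability (borel Z) R) :
  exists Q : probability (borel X) R, forall A : set X,
    measurable (A : set (borel X)) ->
    Q A = (\int[nu]_x th [set w | A (x.1, mul w x.2)])%E.
Proof.
pose r0 (p : borel X * borel Z) : borel X := (p.1.1, mul p.2 p.1.2).
pose rmix := isMeasurableFun.Build _ _ _ _ r0 measurable_rot.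
pose r : {mfun (borel X * borel Z)%type >-> borel X} := HB.pack r0 rmix.
exists (distribution (nu \x th)%E r) => A mA.
rewrite /distribution /pushforward /= /product_measure1.
apply: eq_integral => x _; congr (th _).
by apply/seteqP; split=> z; rewrite /xsection/= inE.
Qed.

Section skew.
Variables (S : Y -> Y) (f : Y -> Z).
Hypotheses (cS : continuous S) (cf : continuous f).
Let T (x : X) : X := (S x.1, mul (f x.1) x.2).

Lemma continuous_skew : continuous T.
Proof.
move=> x; apply: cvg_pair => /=.
  by apply: (@continuous_comp _ _ _ fst S); [exact: cvg_fst|exact: cS].
apply: (@continuous_comp _ _ _ (fun x : X => (f x.1, x.2))
  (fun p : Z * Z => mul p.1 p.2)); last exact: mul_cont.
apply: cvg_pair; last exact: cvg_snd.
by apply: (@continuous_comp _ _ _ fst f); [exact: cvg_fst|exact: cf].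
Qed.

(** As the group is commutative, rotations of the fibres commute with [T]. *)
Lemma convolution_preserves (nu Q : probability (borel X) R)
    (th : probability (borel Z) R) :
  (forall A : set X, measurable (A : set (borel X)) ->
    Q A = (\int[nu]_x th [set w | A (x.1, mul w x.2)])%E) ->
  preserves T nu -> preserves T Q.
Proof.
move=> QE Tnu A mA.
have mTA := measurable_preimage_borel continuous_skew mA.
rewrite !QE//; rewrite -[RHS](ge0_integral_preserves _ Tnu)//; last first.
- exact: measurable_fiber_rot.
- exact: (continuous_borel continuous_skew).
apply: eq_integral => x _; congr (th _); apply/seteqP.
by split=> w /=; rewrite /T/= !mulA [mul _ w]mulC.
Qed.

Variables (haar : probability (borel Z) R) (P : probability (borel Y) R).
Hypothesis haar_rot : forall w (A : set Z), measurable (A : set (borel Z)) ->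
  haar (mul w @^-1` A) = haar A.
Variable mu : probability (borel X) R.
Hypothesis muE : forall A : set X, measurable (A : set (borel X)) ->
  mu A = (\int[P]_y haar [set z | A (y, z)])%E.

(** On each fibre Haar measure absorbs the rotation by [f y]; what remains is a function of the base
    point, integrated against the [S]-invariant [P]. *)
Lemma skew_preserves : preserves S P -> preserves T mu.
Proof.
move=> SP A mA.
have mTA := measurable_preimage_borel continuous_skew mA.
rewrite !muE//; rewrite -[RHS](ge0_integral_preserves _ SP)//; last first.
- exact: measurable_fiber.
- exact: (continuous_borel cS).
apply: eq_integral => y _; rewrite -[RHS](haar_rot (f y))//.
exact: measurable_section.
Qed.

(* Averaging over all rotations forgets everything but the marginal. *)
Lemma convolution_haar (nu : probability (borel X) R) :
  (forall A, measurable (A : set (borel Y)) -> nu (fst @^-1` A) = P A) ->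
  forall A : set X, measurable (A : set (borel X)) ->
    (\int[nu]_x haar [set w | A (x.1, mul w x.2)] = mu A)%E.
Proof.
move=> nuP A mA; rewrite muE//.
transitivity (\int[nu]_x haar [set z | A (x.1, z)])%E.
  apply: eq_integral => x _; rewrite -[RHS](haar_rot x.2).
    by congr (haar _); apply/seteqP; split=> w /=; rewrite mulC.
  exact: measurable_section.
have /esym := @ge0_integral_pushforward _ _ (borel X) (borel Y) R fst
  (@measurable_fst_borel Y Z) nu setT _ measurableT (measurable_fiber haar mA)
  (fun y _ => measure_ge0 _ _).
rewrite preimage_setT => ->.
apply: eq_measure_integral => [|? B mB _]; last exact: nuP.
exact: measurable_fst_borel.
Qed.

End skew.
End group_extension.

(** * Ergodicity *)

Section probability_facts.
Variables (R : realType) (Y : ptopologicalType).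
Implicit Types P Q : probability (borel Y) R.

(** Total masses agree, so the inequality on the complement is the reverse inequality. *)
Lemma probability_le_eq P Q :
  (forall A : set Y, measurable (A : set (borel Y)) -> (P A <= Q A)%E) ->
  forall A : set Y, measurable (A : set (borel Y)) -> Q A = P A.
Proof.
move=> PQ A mA; apply/eqP; rewrite eq_le PQ// andbT.
have mcA : measurable (~` A : set (borel Y)) by exact: measurableC.
have := PQ _ mcA; rewrite !probability_setC//.
rewrite -(fineK (fin_num_measure P _ mA)) -(fineK (fin_num_measure Q _ mA)).
by rewrite -!EFinB !lee_fin lerD2l lerN2.
Qed.

Lemma probability_setD0 P (A B : set Y) : measurable (A : set (borel Y)) ->
  measurable (B : set (borel Y)) -> P B = 0%E -> P A = P (A `\` B).
Proof.
move=> mA mB PB0; rewrite (measureDI P mA mB) [X in (_ + X)%E](_ : _ = 0%E).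
  by rewrite adde0.
apply/eqP; rewrite -measure_le0 -PB0.
by apply: le_measure; rewrite ?inE//; exact: measurableI.
Qed.

Lemma preserves_ae P (S : Y -> Y) (U : Y -> Prop) :
  continuous S -> preserves S P ->
  {ae P, forall x, U x} -> {ae P, forall x, U (S x)}.
Proof.
move=> cS SP [N [mN N0 UN]]; exists (S @^-1` N); split.
- exact: measurable_preimage_borel.
- by rewrite [LHS]SP.
- by move=> x /= nU; apply: UN.
Qed.

(** The set of points whose orbit visits [A] infinitely often is strictly invariant. It differs from
    [A] by a null set, since almost every orbit is either always or never in [A]. *)
Lemma ergodic_ae P (S : Y -> Y) (A : set Y) :
  continuous S -> ergodic P S -> measurable (A : set (borel Y)) ->
  {ae P, forall x, A (S x) <-> A x} ->
  {ae P, forall x, A x} \/ {ae P, forall x, ~ A x}.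
Proof.
move=> cS [SP eP] mA SA.
have SnA n : {ae P, forall x, A (iter n S x) <-> A x}.
  elim: n => [|n IH]; first exact: aeW.
  have := preserves_ae cS SP IH; move: SA.
  apply: (@filterS2 _ _ (ae_filter_ringOfSetsType P)) => x.
  by rewrite iterSr => <-.
have mSn n : measurable (iter n S @^-1` A : set (borel Y)).
  elim: n => [//|n IH].
  rewrite (_ : _ @^-1` _ = S @^-1` (iter n S @^-1` A)).
    exact: measurable_preimage_borel.
  by apply/seteqP; split=> x; rewrite /preimage/= -iterS iterSr.
pose B := \bigcap_n \bigcup_k (iter (n + k) S @^-1` A).
have mB : measurable (B : set (borel Y)).
  by apply: bigcapT_measurable => n; exact: bigcupT_measurable.
have BA : {ae P, forall x, B x <-> A x}.
  move: (ae_foralln SnA).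
  apply: (@filterS _ _ (ae_filter_ringOfSetsType P)) => x SnAx; split.
    by move=> /(_ 0%N Logic.I)[k _]; rewrite /preimage/= => /SnAx.
  by move=> Ax n _; exists 0%N => //=; apply/SnAx.
have SB : S @^-1` B = B.
  apply/seteqP; split=> x /= Bx n _.
    have [k _ /=] := Bx n Logic.I; rewrite -iterSr => Ak.
    by exists k.+1 => //=; rewrite addnS.
  have [k _ /=] := Bx n.+1 Logic.I; rewrite -iterS iterSr => Ak.
  by exists k.
have [B0|B1] := eP _ mB SB; [right|left].
  have : {ae P, forall x, ~ B x}.
    by exists B; split=> // x /= /contrapT.
  by move: BA; apply: (@filterS2 _ _ (ae_filter_ringOfSetsType P)) => x BAx nB /BAx.
have : {ae P, forall x, B x}.
  exists (~` B); split; [exact: measurableC| |by []].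
  by rewrite [LHS]probability_setC// B1 subee.
by move: BA; apply: (@filterS2 _ _ (ae_filter_ringOfSetsType P)) => x BAx /BAx.
Qed.

Lemma uniquely_ergodic_eq P Q (S : Y -> Y) : uniquely_ergodic R S ->
  radon P -> preserves S P -> radon Q -> preserves S Q ->
  forall A : set Y, measurable (A : set (borel Y)) -> Q A = P A.
Proof.
by move=> [P0 [_ _ uP0]] rP SP rQ SQ A mA; rewrite (uP0 Q)// (uP0 P).
Qed.

(* Conditioning [P] on an invariant set gives another invariant measure. *)
Lemma uniquely_ergodic_ergodic P (S : Y -> Y) :
  hausdorff_space Y -> uniquely_ergodic R S -> radon P -> preserves S P ->
  ergodic P S.
Proof.
move=> hY ueS rP SP; split=> // A mA SA.
have [->|PA0] := eqVneq (P A) 0%E; [by left|right].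
have finA : P A \is a fin_num by exact: fin_num_measure.
(* The final [P] is the value of [mnormalize] when the mass to normalize is zero or infinite, which
   is excluded here. *)
pose Q : probability (borel Y) R := mnormalize (mrestr P mA) P.
have QE B : Q B = (P (B `&` A) * (fine (P A))^-1%:E)%E.
  have -> : Q B = (if (P (setT `&` A) == 0%E) || (P (setT `&` A) == +oo%E)
      then P B else P (B `&` A) * (fine (P (setT `&` A)))^-1%:E)%E.
    by rewrite /Q/= /mnormalize /= /mrestr; case: ifP.
  rewrite setTI (negbTE PA0)/= ifF//.
  by apply/negbTE; move: finA; rewrite fin_numE => /andP[].
have c0 : 0 < fine (P A).
  by rewrite fine_gt0// lt0e PA0 measure_ge0 ltey_eq finA.
have rQ : radon Q.
  apply/(radonP hY) => B mB e e0.
  have mBA : measurable (B `&` A : set (borel Y)) by exact: measurableI.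
  (* Normalization divides the error by [P A], so the error is scaled beforehand. *)
  have ec0 : 0 < e * fine (P A) by rewrite mulr_gt0.
  have [K [cK KBA PK]] := (radonP hY P).1 rP _ mBA _ ec0.
  exists K; split=> //; first by move=> x /KBA[].
  rewrite QE lte_pdivrMr// -EFinM.
  apply: le_lt_trans PK.
  have mK := compact_borel hY cK.
  apply: le_measure; rewrite ?inE.
  - by apply: measurableI => //; exact: measurableD.
  - exact: measurableD.
  - by move=> x [[]].
have SQ : preserves S Q.
  move=> B mB; rewrite !QE -(SP _ (measurableI _ _ mB mA)).
  by rewrite preimage_setI SA.
(* The conditioned measure gives [A] mass 1, and uniqueness makes this [P A]. *)
have := uniquely_ergodic_eq ueS rP SP rQ SQ mA.
rewrite QE setIid -[P A in LHS]fineK// -EFinM.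
by rewrite divff ?gt_eqF// => <-.
Qed.

Lemma preserves_cancel P (S S' : Y -> Y) :
  continuous S' -> cancel S S' -> preserves S P -> preserves S' P.
Proof.
move=> cS' SK SP A mA; have <- := SP _ (measurable_preimage_borel cS' mA).
by congr (P _); apply/seteqP; split=> x /=; rewrite SK.
Qed.

Section hahn.
Variables P Q : probability (borel Y) R.
Let nu := cadd (charge_of_finite_measure Q) (copp (charge_of_finite_measure P)).

Let nuE A : nu A = (Q A - P A)%E. Proof. by []. Qed.

Local Open Scope charge_scope.

Let negative_preimage (S S' : Y -> Y) (N : set Y) :
  continuous S -> continuous S' -> cancel S S' -> cancel S' S ->
  preserves S P -> preserves S Q ->
  nu.-negative_set N -> nu.-negative_set (S @^-1` N).
Proof.
move=> cS cS' SK S'K SP SQ [mN nN]; split=> [|A mA AN].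
  exact: measurable_preimage_borel.
have mA' := measurable_preimage_borel cS' mA.
have := nN _ mA'; rewrite !nuE.
rewrite (preserves_cancel cS' SK SP mA) (preserves_cancel cS' SK SQ mA).
by apply=> x /= /AN; rewrite /= S'K.
Qed.

Let negative_iter (S S' : Y -> Y) (N : set Y) n :
  continuous S -> continuous S' -> cancel S S' -> cancel S' S ->
  preserves S P -> preserves S Q ->
  nu.-negative_set N -> nu.-negative_set (iter n S @^-1` N).
Proof.
move=> cS cS' SK S'K SP SQ nN; elim: n => [//|n IH].
rewrite (_ : _ @^-1` _ = S @^-1` (iter n S @^-1` N)).
  exact: (negative_preimage (S' := S')).
by apply/seteqP; split=> x; rewrite /preimage/= -iterS iterSr.
Qed.

(* A Hahn set of [Q - P] saturated by the orbits of [S] is invariant, hence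
   trivial for [P]. *)
Lemma ergodic_dominated (S S' : Y -> Y) :
  continuous S -> continuous S' -> cancel S S' -> cancel S' S ->
  ergodic P S -> preserves S Q ->
  (forall A : set Y, measurable (A : set (borel Y)) -> P A = 0%E -> Q A = 0%E) ->
  forall A : set Y, measurable (A : set (borel Y)) -> Q A = P A.
Proof.
move=> cS cS' SK S'K [SP eP] SQ PQ.
have SP' := preserves_cancel cS' SK SP; have SQ' := preserves_cancel cS' SK SQ.
have [Po [N [[mPo pPo] nN PoN _]]] := Hahn_decomposition nu.
(* Preimages of a negative set under [S] and [S'] are negative, as are countable unions. Taking both
   directions makes [V] strictly invariant. *)
pose V := \bigcup_n (iter n S @^-1` N) `|` \bigcup_n (iter n S' @^-1` N).
have [mV nV] : nu.-negative_set V.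
  apply: negative_setU; apply: bigcup_negative_set => n.
    exact: (negative_iter (S' := S')).
  exact: (negative_iter (S' := S)).
have SV : S @^-1` V = V.
  apply/seteqP; split=> x /= [[n _ /= Nx]|[[|n] _ /= Nx]].
  - by left; exists n.+1 => //=; rewrite -iterS iterSr.
  - by left; exists 1%N.
  - by right; exists n => //=; move: Nx; rewrite -iterS iterSr SK.
  - case: n Nx => [|n] Nx; last first.
      by left; exists n => //=; move: Nx; rewrite /preimage/= -iterS iterSr.
    by right; exists 1%N => //=; rewrite /preimage/= SK.
  - by right; exists 1%N => //=; rewrite SK.
  - by right; exists n.+2 => //=; rewrite -!iterS iterSr SK.
(* If [P V = 0], then [P A] is the mass of [A] outside [V], where [Q - P] is nonnegative; hence
   [P <= Q]. *)
have [PV0|PV1] := eP _ mV SV.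
  apply: probability_le_eq => A mA.
  have mAV : measurable (A `\` V : set (borel Y)) by exact: measurableD.
  have : (0 <= nu (A `\` V))%E.
    apply: pPo => // x [_ nVx]; have : setT x by []; rewrite -PoN => -[//|Nx].
    by case: nVx; left; exists 0%N.
  rewrite nuE sube_ge0 ?fin_num_measure// => /le_trans PQV.
  rewrite (probability_setD0 mA mV PV0); apply: PQV.
  by apply: le_measure; rewrite ?inE.
move=> A mA; apply/esym; move: A mA; apply: probability_le_eq => A mA.
have : (nu (A `&` V) <= 0)%E.
  by apply: nV => //; exact: measurableI.
rewrite nuE sube_le0 => QPV.
(* If [P V = 1], domination makes the complement of [V] null for [Q] as well, and [Q - P] is
   nonpositive inside [V]; hence [Q <= P]. *)
have mcV : measurable (~` V : set (borel Y)) by exact: measurableC.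
have QcV0 : Q (~` V) = 0%E.
  by apply: PQ => //; rewrite [LHS]probability_setC// PV1 subee.
rewrite (probability_setD0 mA mcV QcV0) setDE setCK (le_trans QPV)//.
by apply: le_measure; rewrite ?inE//; exact: measurableI.
Qed.

End hahn.

End probability_facts.

(** * Uniqueness of the invariant measure over an ergodic group extension *)

Section group_extension_unique.
Variables (R : realType) (Y Z : ptopologicalType).
Local Notation X := (Y * Z)%type.
Variables (mul : Z -> Z -> Z) (inv : Z -> Z) (e : Z).
Hypothesis mulA : associative mul.
Hypothesis mulC : commutative mul.
Hypothesis mul_cont : continuous (fun p : Z * Z => mul p.1 p.2).
Hypothesis inv_cont : continuous inv.
Hypothesis mulK : forall w, cancel (mul w) (mul (inv w)).
Hypothesis mulVK : forall w, cancel (mul (inv w)) (mul w).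
Hypothesis invE : forall z, mul (inv e) z = z.
Hypothesis borel_prodP : forall D : set X,
  measurable (D : set (borel X)) -> measurable (D : set (borel Y * borel Z)).
Hypothesis borel_prodZP : forall D : set (Z * Z),
  measurable (D : set (borel (Z * Z)%type)) ->
  measurable (D : set (borel Z * borel Z)).
Hypotheses (hY : hausdorff_space Y) (hZ : hausdorff_space Z).
Variables (S S' : Y -> Y) (f : Y -> Z).
Hypotheses (cS : continuous S) (cS' : continuous S') (cf : continuous f).
Hypotheses (SK : cancel S S') (S'K : cancel S' S).
Let T (x : X) : X := (S x.1, mul (f x.1) x.2).
Let T' (x : X) : X := (S' x.1, mul (inv (f (S' x.1))) x.2).
Variables (haar : probability (borel Z) R) (P : probability (borel Y) R).
Hypothesis haar_rot : forall w (A : set Z), measurable (A : set (borel Z)) ->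
  haar (mul w @^-1` A) = haar A.
Hypothesis haar_open : forall U : set Z, open U -> U e -> haar U != 0%E.
Variable mu : probability (borel X) R.
Hypothesis muE : forall A : set X, measurable (A : set (borel X)) ->
  mu A = (\int[P]_y haar [set z | A (y, z)])%E.
Hypotheses (rmu : radon mu) (emu : ergodic mu T).
Variable nu : probability (borel X) R.
Hypotheses (rnu : radon nu) (Tnu : preserves T nu).
Hypothesis nuP :
  forall A, measurable (A : set (borel Y)) -> nu (fst @^-1` A) = P A.

Let cT : continuous T. Proof. exact: (continuous_skew mul_cont cS cf). Qed.

Let cT' : continuous T'.
Proof.
have cif : continuous (inv \o f).
  move=> y; apply: (@continuous_comp _ _ _ f inv); first exact: cf.
  exact: inv_cont.
have ci : continuous ((inv \o f) \o S').
  move=> y; apply: (@continuous_comp _ _ _ S' (inv \o f)); first exact: cS'.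
  exact: cif.
exact: (continuous_skew mul_cont cS' ci).
Qed.

Let TK : cancel T T'.
Proof. by move=> [y z]; rewrite /T /T'/= SK mulK. Qed.

Let T'K : cancel T' T.
Proof. by move=> [y z]; rewrite /T /T'/= S'K mulVK. Qed.

(* [nu] smeared over the rotations by [w \in W] is dominated by its Haar
   average [mu], hence equal to [mu] by ergodicity. *)
Lemma smeared_measure (W : set Z) : open W -> W e ->
  forall K U : set X, measurable (K : set (borel X)) ->
  measurable (U : set (borel X)) ->
  (forall x w, W w -> K (x.1, mul w x.2) -> U x) -> (mu K <= nu U)%E.
Proof.
move=> oW We K U mK mU KU.
have mW : measurable (W : set (borel Z)) by exact: open_borel.
(* Haar measure conditioned on [W], which has positive mass by [haar_open]. *)
pose th : probability (borel Z) R := mnormalize (mrestr haar mW) haar.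
pose c := fine (haar W).
have cE : haar W = c%:E by rewrite fineK// fin_num_measure.
have c0 : 0 < c.
  by rewrite -lte_fin -cE lt0e haar_open// measure_ge0.
have thE B : th B = (haar (B `&` W) * c^-1%:E)%E.
  have -> : th B = (if (haar (setT `&` W) == 0%E) ||
      (haar (setT `&` W) == +oo%E) then haar B
      else haar (B `&` W) * (fine (haar (setT `&` W)))^-1%:E)%E.
    by rewrite /th/= /mnormalize /= /mrestr; case: ifP.
  by rewrite setTI cE/= eqe gt_eqF.
have [Q QE] := fiber_convolution mul_cont borel_prodP borel_prodZP nu th.
have TQ : preserves T Q.
  exact: (convolution_preserves mulA mulC mul_cont borel_prodP borel_prodZP
    cS cf QE Tnu).
have mfib D : measurable (D : set (borel X)) -> forall x : X,
    measurable ([set w | D (x.1, mul w x.2)] : set (borel Z)).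
  move=> mD x; have := measurable_section borel_prodP x.1 mD => mDx.
  rewrite (_ : mkset _ = mul x.2 @^-1` [set z | D (x.1, z)]); last first.
    by apply/seteqP; split=> w /=; rewrite mulC.
  apply: measurable_preimage_borel mDx => w.
  apply: (@continuous_comp _ _ _ (fun w : Z => (x.2, w))
    (fun p : Z * Z => mul p.1 p.2)); last exact: mul_cont.
  by apply: cvg_pair; [exact: cvg_cst|exact: cvg_id].
(* Since [th] is at most [c^-1] times Haar measure, [Q D] is at most [c^-1] times the average of
   [nu] over all rotations, which is [mu D]. So [mu]-null sets are [Q]-null. *)
have QK : Q K = mu K.
  apply: (ergodic_dominated cT cT' TK T'K emu TQ) => // D mD mD0.
  rewrite QE//; apply/eqP; rewrite eq_le integral_ge0 ?andbT//.
  apply: (@le_trans _ _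
      (\int[nu]_x (c^-1%:E * haar [set w | D (x.1, mul w x.2)]))%E).
    apply: ge0_le_integral => //.
    - exact: (measurable_fiber_rot mul_cont borel_prodP borel_prodZP th mD).
    - apply: emeasurable_funM => //.
      exact: (measurable_fiber_rot mul_cont borel_prodP borel_prodZP haar mD).
    - move=> x _; rewrite [leLHS]thE muleC lee_pmul2l ?lte_fin ?invr_gt0//.
      apply: le_measure; rewrite ?inE//; last exact: mfib.
      by apply: measurableI => //; exact: mfib.
  rewrite ge0_integralZl//; first last.
  - by rewrite lee_fin invr_ge0 ltW.
  - exact: (measurable_fiber_rot mul_cont borel_prodP borel_prodZP haar mD).
  rewrite (convolution_haar mulC borel_prodP haar_rot muE nuP mD).
  by rewrite mD0 mule0.
rewrite -QK QE//.
(* [th] is carried by [W], and outside [U] no [w] in [W] moves the point into [K]. *)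
apply: (@le_trans _ _ (\int[nu]_x (\1_U x)%:E)%E).
  apply: ge0_le_integral => //.
  - exact: (measurable_fiber_rot mul_cont borel_prodP borel_prodZP th mK).
  - exact/measurable_EFinP.
  - move=> x _; rewrite indicE; have [|xU] := boolP (x \in U).
      by move=> _; apply: probability_le1; exact: mfib.
    rewrite [leLHS]thE (_ : _ `&` W = set0) ?measure0 ?mul0e//.
    apply/seteqP; split=> // w [/= Kw Ww]; move/negP: xU; apply.
    by rewrite inE; exact: KU Kw.
by rewrite integral_indic// setIT.
Qed.

(** By inner regularity, [mu K <= nu K] for compact [K] is enough. [K] is enclosed in an open set of
    almost the same [nu]-measure, and a small enough [W] keeps the rotated copies of [K] inside
    it. *)
Lemma ergodic_extension_unique (A : set X) :
  measurable (A : set (borel X)) -> nu A = mu A.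
Proof.
move: A; apply: probability_le_eq => A mA.
have hX := hausdorff_prod hY hZ.
rewrite rmu// rnu//; apply: ge_ereal_sup => _ [K [cK KA] <-].
apply: (@le_trans _ _ (nu K)); last by apply: ereal_sup_ubound; exists K.
have mK := compact_borel hX cK.
have mcK : measurable (~` K : set (borel X)) by exact: measurableC.
apply/lee_addgt0Pr => d d0.
(* Inner regularity on the complement of [K] acts as outer regularity of [K]: the complement of [L]
   is open, contains [K] and exceeds it by less than [d]. *)
have [L [cL LK PL]] := (radonP hX nu).1 rnu _ mcK _ d0.
have mL := compact_borel hX cL.
have oU : open (~` L) by apply: closed_openC; exact: compact_closed.
(* Each point of [K] stays off [L] under all rotations near the identity; compactness of [K] makes
   the neighbourhood of [e] uniform. *)
have : nbhs e [set w | K `<=` [set k : X | (~` L) (k.1, mul (inv w) k.2)]].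
  apply: ((compact_near_coveringP K).1 cK _ (nbhs e)
    (fun w (k : X) => (~` L) (k.1, mul (inv w) k.2))) => k Kk.
  have cr : continuous (fun p : X * Z => (p.1.1, mul (inv p.2) p.1.2) : X).
    move=> p; apply: cvg_pair => /=.
      by apply: (@continuous_comp _ _ _ fst fst); exact: cvg_fst.
    apply: (@continuous_comp _ _ _ (fun p : X * Z => (inv p.2, p.1.2))
      (fun p : Z * Z => mul p.1 p.2)); last exact: mul_cont.
    apply: cvg_pair => /=.
      apply: (@continuous_comp _ _ _ snd inv); first exact: cvg_snd.
      exact: inv_cont.
    by apply: (@continuous_comp _ _ _ fst snd); [exact: cvg_fst|exact: cvg_snd].
  apply: (cr (k, e) (~` L)); apply: open_nbhs_nbhs; split=> //=.
  by rewrite invE -surjective_pairing => /LK.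
rewrite nbhsE => -[W [oW We] WK].
apply: (@le_trans _ _ (nu (~` L))).
  apply: (smeared_measure oW We) => //; first exact: measurableC.
  by move=> x w /WK /= /[apply]/=; rewrite mulK -surjective_pairing.
rewrite (_ : ~` L = K `|` (~` K `\` L)); last first.
  apply/seteqP; split=> x.
    by have [Kx|nKx] := pselect (K x); [left|right].
  by move=> [Kx /LK|[]].
rewrite (le_trans (measureU2 _ mK _))//; first exact: measurableD.
by rewrite leeD// ltW.
Qed.

End group_extension_unique.

(** * Invariant functions that change sign under a measure-preserving map *)

Section antiinvariant.
Variables (R : realType) (Y : ptopologicalType) (P : probability (borel Y) R).

Lemma ae_probability_false : ~ {ae P, forall y, False}.
Proof.
move=> [N [mN N0 NT]]; have : P setT = 0%E.
  apply/eqP; rewrite -measure_le0 -N0.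
  by apply: le_measure; rewrite ?inE// => y _; apply: NT.
by rewrite probability_setT => /eqP; rewrite onee_eq0.
Qed.

(** The set where [phi] is positive is null or conull by ergodicity. Conull is impossible, as [rho]
    would make [- phi] positive almost everywhere too; null gives [phi <= 0], and through [rho] also
    [- phi <= 0]. *)
Lemma antiinvariant_ae0 (S rho : Y -> Y) (phi : Y -> R) :
  continuous S -> continuous rho -> ergodic P S -> preserves rho P ->
  measurable_fun [set: borel Y] phi ->
  {ae P, forall y, phi (S y) = phi y} -> (forall y, phi (rho y) = - phi y) ->
  {ae P, forall y, phi y = 0}.
Proof.
move=> cS crho eP rhoP mphi Sphi rhophi.
have mA : measurable ([set y | 0 < phi y] : set (borel Y)).
  have := mphi measurableT _ (measurable_itv `]0, +oo[); rewrite setTI.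
  congr measurable; apply/seteqP.
  by split=> y; rewrite /preimage/= in_itv/= andbT.
have [|ae1|ae1] := @ergodic_ae R Y P S [set y | 0 < phi y] cS eP mA.
- move: Sphi; apply: (@filterS _ _ (ae_filter_ringOfSetsType P)) => y /=.
  by move=> ->.
- case: ae_probability_false; have := preserves_ae crho rhoP ae1.
  move: ae1; apply: (@filterS2 _ _ (ae_filter_ringOfSetsType P)) => y /=.
  by rewrite rhophi oppr_gt0 => /lt_trans /[apply]; rewrite ltxx.
- have := preserves_ae crho rhoP ae1.
  move: ae1; apply: (@filterS2 _ _ (ae_filter_ringOfSetsType P)) => y /=.
  rewrite rhophi oppr_gt0 => /negP + /negP; rewrite -!leNgt => p1 p2.
  by apply/eqP; rewrite eq_le p1 p2.
Qed.

Lemma antiinvariant_complex_ae0 (S rho : Y -> Y) (h : Y -> R[i]) :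
  continuous S -> continuous rho -> ergodic P S -> preserves rho P ->
  measurable_fun [set: borel Y] (fun y => complex.Re (h y)) ->
  measurable_fun [set: borel Y] (fun y => complex.Im (h y)) ->
  {ae P, forall y, h (S y) = h y} -> (forall y, h (rho y) = - h y) ->
  {ae P, forall y, h y = 0}.
Proof.
move=> cS crho eP rhoP mre mim hS hrho.
have re0 : {ae P, forall y, complex.Re (h y) = 0}.
  apply: (antiinvariant_ae0 cS crho eP rhoP mre); last first.
    by move=> y; rewrite hrho raddfN.
  by move: hS; apply: (@filterS _ _ (ae_filter_ringOfSetsType P)) => y ->.
have im0 : {ae P, forall y, complex.Im (h y) = 0}.
  apply: (antiinvariant_ae0 cS crho eP rhoP mim); last first.
    by move=> y; rewrite hrho raddfN.
  by move: hS; apply: (@filterS _ _ (ae_filter_ringOfSetsType P)) => y ->.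
move: re0 im0; apply: (@filterS2 _ _ (ae_filter_ringOfSetsType P)) => y ry iy.
by apply/eqP; rewrite eq_complex ry iy !eqxx.
Qed.

End antiinvariant.

(** * Characters of the circle *)

Section characters.
Variable R : realType.
Local Notation C := (circle R).

Lemma circle_neq0 (z : C) : circle_val z != 0.
Proof. by rewrite -normr_eq0 circle_norm oner_eq0. Qed.

Lemma continuous_circle_expn (n : nat) :
  continuous (fun z : C => complex.Re (circle_val z ^+ n)) /\
  continuous (fun z : C => complex.Im (circle_val z ^+ n)).
Proof.
elim: n => [|n [IHr IHi]].
  by split=> z; under eq_fun do rewrite expr0; exact: cst_continuous.
have reS : (fun z : C => complex.Re (circle_val z ^+ n.+1)) = (fun z : C =>
    complex.Re (circle_val z) * complex.Re (circle_val z ^+ n) -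
    complex.Im (circle_val z) * complex.Im (circle_val z ^+ n)).
  by apply/funext => z; rewrite exprS complex_ReM.
have imS : (fun z : C => complex.Im (circle_val z ^+ n.+1)) = (fun z : C =>
    complex.Re (circle_val z) * complex.Im (circle_val z ^+ n) +
    complex.Im (circle_val z) * complex.Re (circle_val z ^+ n)).
  by apply/funext => z; rewrite exprS complex_ImM.
have cM (a b : C -> R) : continuous a -> continuous b ->
  continuous (fun z => a z * b z) by move=> ca cb z; exact: cvgM (ca z) (cb z).
have cre := @continuous_circle_re R; have cim := @continuous_circle_im R.
rewrite reS imS; split=> z.
- exact: (cvgB (cM _ _ cre IHr z) (cM _ _ cim IHi z)).
- exact: (cvgD (cM _ _ cre IHi z) (cM _ _ cim IHr z)).
Qed.

Lemma circle_exprN (z : C) (n : nat) :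
  circle_val z ^ (- n%:Z) = ((circle_val z ^+ n)^*)%C.
Proof.
by rewrite -exprnN -exprVn -circle_conjE /= -rmorphXn.
Qed.

Lemma continuous_circle_exprz (n : int) :
  continuous (fun z : C => complex.Re (circle_val z ^ n)) /\
  continuous (fun z : C => complex.Im (circle_val z ^ n)).
Proof.
have ReJ (u : R[i]) : complex.Re (u^*)%C = complex.Re u by case: u.
have ImJ (u : R[i]) : complex.Im (u^*)%C = - complex.Im u by case: u.
case: (intP n) => [|m|m].
- exact: (continuous_circle_expn 0).
- exact: (continuous_circle_expn m.+1).
- have [cr ci] := continuous_circle_expn m.+1.
  have reE : (fun z : C => complex.Re (circle_val z ^ (- m.+1%:Z))) =
      (fun z : C => complex.Re (circle_val z ^+ m.+1)).
    by apply/funext => z; rewrite circle_exprN ReJ.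
  have imE : (fun z : C => complex.Im (circle_val z ^ (- m.+1%:Z))) =
      (fun z : C => - complex.Im (circle_val z ^+ m.+1)).
    by apply/funext => z; rewrite circle_exprN ImJ.
  rewrite reE imE; split=> z; first exact: cr.
  exact: cvgN (ci z).
Qed.

Lemma expi_nat (t : R) (n : nat) :
  circle_val (expi t) ^+ n = circle_val (expi (n%:R * t)).
Proof.
elim: n => [|n IH]; first by rewrite expr0 mul0r circle_val_expi mulr0 cos0 sin0.
by rewrite exprS IH -natr1 mulrDl mul1r addrC expiD circle_valM.
Qed.

(** The witness is the angle pi / |n|, half a turn after |n| steps; conjugation settles negative
    [n]. Rotation by it negates the character of exponent [n]. *)
Lemma circle_root_N1 (n : int) : n != 0 -> exists w : C, circle_val w ^ n = -1.
Proof.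
have H (m : nat) : circle_val (@expi R ((2 * m.+1%:R)^-1)) ^+ m.+1 = -1.
  rewrite expi_nat circle_val_expi.
  rewrite (_ : 2 * pi * _ = pi); last first.
    have : m.+1%:R != 0 :> R by rewrite pnatr_eq0.
    move: (m.+1%:R : R) => k k0.
    by rewrite invfM [k * _]mulrCA divff// mulr1 mulrAC divff// mul1r.
  by rewrite cospi sinpi; apply/eqP; rewrite eq_complex/= oppr0 !eqxx.
case: (intP n) => [//|m _|m _]; exists (expi (2 * m.+1%:R)^-1).
  exact: H.
by rewrite circle_exprN H rmorphN1.
Qed.

End characters.

(** * Fourier coefficients on the circle *)

Lemma probability_integral_cst d (T : measurableType d) (R : realType)
    (P : probability T R) (r : R) : (\int[P]_y (cst r%:E y) = r%:E)%E.
Proof.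
rewrite integral_cst//; transitivity (r%:E * 1)%E; last by rewrite mule1.
by congr (_ * _)%E; exact: probability_setT.
Qed.

(* Convolution with the normalized powers of a kernel [q <= 1] that equals [1]
   only at [e] approximates the identity.  If it maps [\1_B] to a constant,
   then [B] is null or conull. *)
Section peak_kernel.
Variables (R : realType) (Z : ptopologicalType).
Variables (mul : Z -> Z -> Z) (inv : Z -> Z) (e : Z).
Hypothesis mul_cont : continuous (fun p : Z * Z => mul p.1 p.2).
Hypothesis inv_cont : continuous inv.
Hypothesis mulVK : forall w, cancel (mul (inv w)) (mul w).
Hypothesis mule : forall w, mul w e = w.
Hypothesis borel_prodZP : forall D : set (Z * Z),
  measurable (D : set (borel (Z * Z)%type)) ->
  measurable (D : set (borel Z * borel Z)).
Hypothesis hZ : hausdorff_space Z.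
Variable haar : probability (borel Z) R.
Hypothesis haar_rot : forall w (A : set Z), measurable (A : set (borel Z)) ->
  haar (mul w @^-1` A) = haar A.
Hypothesis haar_open : forall U : set Z, open U -> U e -> haar U != 0%E.
Hypothesis rhaar : radon haar.
Variable q : Z -> R.
Hypothesis q_cont : continuous q.
Hypothesis q_ge0 : forall z, 0 <= q z.
Hypothesis q_le1 : forall z, q z <= 1.
Hypothesis q1 : forall z, q z = 1 -> z = e.
Hypothesis qe : q e = 1.
Hypothesis q_sym : forall z w, q (mul (inv w) z) = q (mul (inv z) w).
Variable B : set Z.
Hypothesis mB : measurable (B : set (borel Z)).
Hypothesis qB : forall N w,
  (\int[haar]_z (q (mul (inv w) z) ^+ N * \1_B z)%:E =
   haar B * \int[haar]_z (q z ^+ N)%:E)%E.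

Let c N := (\int[haar]_z (q z ^+ N)%:E)%E.

Let mq N : measurable_fun [set: borel Z] (fun z => q z ^+ N).
Proof. by apply: measurable_funX; exact: continuous_borelR. Qed.

Let cqq : continuous (fun p : Z * Z => q (mul (inv p.1) p.2)).
Proof.
move=> p; apply: (@continuous_comp _ _ _ (fun p : Z * Z => mul (inv p.1) p.2) q);
  last exact: q_cont.
apply: (@continuous_comp _ _ _ (fun p : Z * Z => (inv p.1, p.2))
  (fun p : Z * Z => mul p.1 p.2)); last exact: mul_cont.
apply: cvg_pair => /=; last exact: cvg_snd.
by apply: (@continuous_comp _ _ _ fst inv); [exact: cvg_fst|exact: inv_cont].
Qed.

Let mqq N (D : set Z) : measurable (D : set (borel Z)) ->
  measurable_fun [set: borel Z * borel Z]
    (fun p => (q (mul (inv p.1) p.2) ^+ N * \1_D p.2)%:E).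
Proof.
move=> mD; apply/measurable_EFinP; apply: measurable_funM.
  apply: measurable_funX => _ A mA; rewrite setTI; apply: borel_prodZP.
  by rewrite -[X in measurable X]setTI; exact: continuous_borelR.
apply: (@measurableT_comp _ _ _ _ _ _ (\1_D : borel Z -> R)) => //.
Qed.

Let c_fin N : c N = (fine (c N))%:E.
Proof.
rewrite fineK// ge0_fin_numE ?integral_ge0//; last first.
  by move=> z _; rewrite lee_fin exprn_ge0.
apply: (@le_lt_trans _ _ (\int[haar]_z (cst 1%:E z))%E).
  apply: ge0_le_integral => //.
  - by move=> z _; rewrite lee_fin exprn_ge0.
  - exact/measurable_EFinP.
  - by move=> z _; rewrite lee_fin exprn_ile1.
by rewrite probability_integral_cst ltry.
Qed.

(** The integral of [q ^+ N] decays no faster than [rho ^+ N] for any [rho < 1]: [q] exceeds [rho]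
    on a neighbourhood of [e], which has positive mass. *)
Let c_ge rho : 0 <= rho -> rho < 1 ->
  exists2 d : R, 0 < d & forall N, rho ^+ N * d <= fine (c N).
Proof.
move=> rho0 rho1; pose U := [set z | rho < q z].
have oU : open U by move/continuousP : q_cont => /(_ _ (@open_gt R rho)).
have mU : measurable (U : set (borel Z)) by exact: open_borel.
have Ue : U e by rewrite /U/= qe.
exists (fine (haar U)).
  by rewrite -lte_fin fineK ?fin_num_measure// lt0e haar_open// measure_ge0.
move=> n; rewrite -lee_fin -c_fin EFinM fineK ?fin_num_measure//.
rewrite -integral_cst// integral_mkcond; apply: ge0_le_integral => //.
- by move=> z _; rewrite patchE; case: ifP => //= _; rewrite lee_fin exprn_ge0.
- by apply/(measurable_restrictT _ _).1.
- exact/measurable_EFinP.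
- move=> z _; rewrite patchE; case: ifPn => [|_]; last first.
    by rewrite lee_fin exprn_ge0.
  by rewrite inE/= lee_fin => /ltW qz; rewrite lerXn2r// nnegrE.
Qed.

(** [qB] is integrated over [w] in [L]. The part of [B] in [K] contributes at most [r ^+ N]; the
    rest is bounded by integrating over all [w], where exchanging the integrals gives [c N] times
    its measure. *)
Let smear (L K : set Z) (r : R) N : 0 <= r -> K `<=` B ->
  measurable (L : set (borel Z)) -> measurable (K : set (borel Z)) ->
  (forall w z, L w -> K z -> q (mul (inv w) z) <= r) ->
  (haar B * c N * haar L <= (r ^+ N)%:E + c N * haar (B `\` K))%E.
Proof.
move=> r0 KB mL mK qr; pose D := B `\` K.
have mD : measurable (D : set (borel Z)) by exact: measurableD.
pose h A w := (\int[haar]_z (q (mul (inv w) z) ^+ N * \1_A z)%:E)%E.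
have q0 z w : (0 <= q (mul (inv w) z) ^+ N)%R by rewrite exprn_ge0.
have h0 A w : (0 <= h A w)%E.
  by apply: integral_ge0 => z _; rewrite lee_fin mulr_ge0.
have mqw A w : measurable (A : set (borel Z)) -> measurable_fun [set: borel Z]
    (fun z => (q (mul (inv w) z) ^+ N * \1_A z)%:E).
  move=> mA.
  exact: (@measurable_fun_pair2 _ _ _ (borel Z) (borel Z) _ _ w (mqq N mA)).
have mh : measurable_fun [set: borel Z] (h D).
  apply: (measurable_fun_fubini_tonelli_F _ (mqq N mD)) => -[w z].
  by rewrite lee_fin mulr_ge0.
have hL w : (haar B * c N * (\1_L w)%:E <= (r ^+ N)%:E + h D w)%E.
  rewrite indicE; have [wL|_] := boolP (w \in L); last first.
    by rewrite mule0 adde_ge0// lee_fin exprn_ge0.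
  rewrite mule1 /c -(qB N w) -/(h B w).
  have -> : (r ^+ N)%:E = (\int[haar]_z (cst (r ^+ N)%:E z))%E.
    by rewrite probability_integral_cst.
  rewrite -ge0_integralD//; last 3 first.
  - by move=> z _; rewrite lee_fin exprn_ge0.
  - by move=> z _; rewrite lee_fin mulr_ge0.
  - exact: mqw.
  apply: ge0_le_integral => //.
  - by move=> z _; rewrite lee_fin mulr_ge0.
  - exact: mqw.
  - by apply: emeasurable_funD => //; exact: mqw.
  - move=> z _; rewrite -EFinD lee_fin /D !indicE in_setD.
    have [zB|zB] := boolP (z \in B); have [zK|zK] := boolP (z \in K) => //=;
      rewrite ?mulr1 ?mulr0 ?addr0 ?exprn_ge0// ?lerDr ?exprn_ge0//.
    by rewrite lerXn2r ?nnegrE//; apply: qr; rewrite -inE.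
have hD : (\int[haar]_w h D w = c N * haar D)%E.
  rewrite /h (fubini_tonelli _ (mqq N mD))/=; last first.
    by move=> [w z]; rewrite lee_fin mulr_ge0.
  transitivity (\int[haar]_z (c N * (\1_D z)%:E))%E.
    apply: eq_integral => z _.
    have mi : measurable_fun [set: borel Z] (mul (inv z) : _ -> borel Z).
      apply: continuous_borel => w.
      apply: (@continuous_comp _ _ _ (fun w : Z => (inv z, w))
        (fun p : Z * Z => mul p.1 p.2)); last exact: mul_cont.
      by apply: cvg_pair; [exact: cvg_cst|exact: cvg_id].
    have pz : preserves (mul (inv z)) haar by exact: haar_rot.
    (* By symmetry of the kernel, the inner integral over [w] is that of a translate of [q ^+ N],
       hence [c N]. *)
    transitivity (\int[haar]_w ((\1_D z)%:E * (q (mul (inv z) w) ^+ N)%:E))%E.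
      by apply: eq_integral => w _; rewrite q_sym EFinM muleC.
    have m1 : measurable_fun [set: borel Z]
        (fun w => (q (mul (inv z) w) ^+ N)%:E).
      by apply/measurable_EFinP; exact: (measurableT_comp (mq N) mi).
    have n1 w : setT w -> (0 <= (q (mul (inv z) w) ^+ N)%:E)%E.
      by rewrite lee_fin.
    have k0 : (0 <= (\1_D z)%:E :> \bar R)%E by rewrite lee_fin.
    rewrite (ge0_integralZl haar measurableT m1 n1 k0) muleC; congr (_ * _)%E.
    apply: (ge0_integral_preserves mi pz (h := fun z => (q z ^+ N)%:E)).
      exact/measurable_EFinP.
    by move=> ?; rewrite lee_fin exprn_ge0.
  rewrite ge0_integralZl//.
  - by rewrite integral_indic// setIT.
  - exact/measurable_EFinP.
  - by rewrite integral_ge0// => z _; rewrite lee_fin exprn_ge0.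
have -> : (haar B * c N * haar L = \int[haar]_w (haar B * c N * (\1_L w)%:E))%E.
  rewrite ge0_integralZl//.
  - by rewrite integral_indic// setIT.
  - exact/measurable_EFinP.
  - by rewrite mule_ge0// integral_ge0// => z _; rewrite lee_fin exprn_ge0.
rewrite -hD.
have -> : (r ^+ N)%:E = (\int[haar]_z (cst (r ^+ N)%:E z))%E.
  by rewrite probability_integral_cst.
rewrite -ge0_integralD//; last first.
  by move=> z _; rewrite lee_fin exprn_ge0.
apply: ge0_le_integral => //.
- move=> w _; rewrite !mule_ge0// ?lee_fin// integral_ge0// => z _.
  by rewrite lee_fin exprn_ge0.
- apply: emeasurable_funM => //; exact/measurable_EFinP.
- exact: emeasurable_funD.
Qed.

(** For disjoint [L] and [K] the kernel is below 1 at each pair, since [q] is 1 only at [e];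
    compactness of the product makes the bound uniform. *)
Let separated (L K : set Z) : compact L -> compact K -> L `&` K = set0 ->
  exists r : R, [/\ 0 <= r, r < 1 &
    forall w z, L w -> K z -> q (mul (inv w) z) <= r].
Proof.
move=> cL cK LK.
have cLK := compact_setX cL cK.
have : nbhs (1 : R)^'- [set r : R | L `*` K `<=`
    [set p : Z * Z | q (mul (inv p.1) p.2) < r]].
  apply: ((compact_near_coveringP (L `*` K)).1 cLK _ ((1 : R)^'-)
    (fun r (p : Z * Z) => q (mul (inv p.1) p.2) < r)) => -[w z] [/= Lw Kz].
  have qlt : q (mul (inv w) z) < 1.
    rewrite lt_neqAle q_le1 andbT; apply/eqP => /q1 E.
    have : z = w by rewrite -(mulVK w z) E mule.
    move=> zw; have : (L `&` K) z by split=> //; rewrite zw.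
    by rewrite LK.
  (* The midpoint [m] works on a neighbourhood of the pair and for all [r > m] at once, as the
     near-covering form of compactness asks. *)
  have [m /andP[qm m1]] : exists m, q (mul (inv w) z) < m < 1.
    by exists ((q (mul (inv w) z) + 1) / 2); apply/andP; split; lra.
  have nwz : nbhs ((w, z) : Z * Z) [set p : Z * Z | q (mul (inv p.1) p.2) < m].
    apply: open_nbhs_nbhs; split=> //.
    by move/continuousP : cqq => /(_ _ (@open_lt R m)).
  exists ([set p : Z * Z | q (mul (inv p.1) p.2) < m], [set r | m < r]).
    by split; [exact: nwz|exact: nbhs_left_gt].
  by move=> [[w' z'] r] [/= h1 h2]; exact: lt_trans h2.
move=> H.
have : nbhs (1 : R)^'- [set r : R | [/\ 0 <= r, r < 1 & L `*` K `<=`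
    [set p : Z * Z | q (mul (inv p.1) p.2) < r]]].
  near=> r; split; near: r.
  - exact: nbhs_left_ge.
  - exact: nbhs_left_lt.
  - exact: H.
move=> /(@filter_ex _ _ (at_left_proper_filter 1))[r [r0 r1 Hr]].
exists r; split=> // w z Lw Kz.
by apply/ltW/(Hr (w, z)).
Unshelve. all: by end_near. Qed.

(** With [K] in [B] and [L] in its complement, [smear] divided by [c N] gives [b * l <= k] in the
    limit, where [l] is close to [1 - b] and [k] to 0. Hence [b * (1 - b) <= 0]. *)
Lemma peak_kernel_trivial : haar B = 0%E \/ haar B = 1%E.
Proof.
have mcB : measurable (~` B : set (borel Z)) by exact: measurableC.
pose b := fine (haar B).
have bE : haar B = b%:E by rewrite fineK// fin_num_measure.
have b0 : 0 <= b by rewrite -lee_fin -bE measure_ge0.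
have b1 : b <= 1 by rewrite -lee_fin -bE probability_le1.
suff : b * (1 - b) <= 0.
  move=> bb; have : b * (1 - b) == 0.
    by rewrite eq_le bb mulr_ge0// subr_ge0.
  rewrite mulf_eq0 subr_eq0 bE => /orP[/eqP->|/eqP<-]; [by left|by right].
apply/ler_addgt0Pl => d d0; rewrite addr0.
have d20 : 0 < d / 2 by rewrite divr_gt0.
have [K [cK KB BK]] := (radonP hZ haar).1 rhaar _ mB _ d20.
have [L [cL LB BL]] := (radonP hZ haar).1 rhaar _ mcB _ d20.
have mK := compact_borel hZ cK; have mL := compact_borel hZ cL.
have LK0 : L `&` K = set0.
  by apply/seteqP; split=> // z [/LB nBz /KB].
have [r [r0 r1 qr]] := separated cL cK LK0.
pose l := fine (haar L); pose k := fine (haar (B `\` K)).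
have lE : haar L = l%:E by rewrite fineK// fin_num_measure.
have mBK : measurable (B `\` K : set (borel Z)) by exact: measurableD.
have kE : haar (B `\` K) = k%:E by rewrite fineK// fin_num_measure.
have bl : 1 - b - l <= d / 2.
  have mBL : measurable (~` B `\` L : set (borel Z)) by exact: measurableD.
  rewrite -lee_fin; apply: le_trans (ltW BL).
  have -> : haar (~` B `\` L) = (haar (~` B) - haar L)%E.
    rewrite -[in RHS](setIidr LB); apply: measureD => //.
    by rewrite ltey_eq fin_num_measure.
  by rewrite probability_setC// bE lE.
have kd : k <= d / 2 by rewrite -lee_fin -kE ltW.
(* Strictly between [r] and 1, so that [r ^+ N] is negligible against the lower bound [rho ^+ N * s]
   of [c N]. *)
pose rho := (r + 1) / 2.
have rho0 : 0 < rho by rewrite /rho; lra.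
have [s s0 cs] := @c_ge rho (ltW rho0) ltac:(rewrite /rho; lra).
have blk : b * l <= k.
  rewrite leNgt; apply/negP => kbl.
  have x0 : 0 < (b * l - k) * s by rewrite mulr_gt0// subr_gt0.
  have t1 : `|r / rho| < 1.
    have -> : `|r / rho| = r / rho by rewrite ger0_norm// divr_ge0// ltW.
    by rewrite ltr_pdivrMr// mul1r /rho; lra.
  have /cvgr_lt/(_ _ x0) := cvg_expr t1; move=> -[N _ /(_ N (leqnn N)) /= rN].
  have {rN} : (r / rho) ^+ N < (b * l - k) * s by exact: rN.
  apply/negP; rewrite -leNgt -(ler_pM2r (exprn_gt0 N rho0)).
  have -> : (r / rho) ^+ N * rho ^+ N = r ^+ N.
    by rewrite -exprMn divfK ?gt_eqF.
  have := smear N r0 KB mL mK qr.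
  rewrite bE lE kE c_fin -!EFinM -EFinD lee_fin => H.
  have : (b * l - k) * (rho ^+ N * s) <= (b * l - k) * fine (c N).
    by rewrite ler_wpM2l// subr_ge0 ltW.
  nra.
nra.
Qed.

End peak_kernel.

(** * Bounded real integrands *)

Section Rintegral_probability.
Variables (d : measure_display) (T : measurableType d) (R : realType).
Variable P : probability T R.

Lemma integrable_bounded (h : T -> R) (M : R) :
  measurable_fun [set: T] h -> (forall y, `|h y| <= M) ->
  P.-integrable [set: T] (EFin \o h).
Proof.
move=> mh hM; apply: measurable_bounded_integrable => //.
  by rewrite ltey_eq fin_num_measure.
exists M; split; first exact: num_real.
by move=> x Mx y _ /=; rewrite (le_trans (hM y))// ltW.
Qed.

Lemma EFin_Rintegral (h : T -> R) : P.-integrable [set: T] (EFin \o h) ->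
  (\int[P]_y (h y)%:E)%E = (\int[P]_y h y)%:E.
Proof.
by move=> ih; rewrite /Rintegral fineK//; exact: integrable_fin_num.
Qed.

Lemma RintegralM_comb (a b : R) (g h : T -> R) :
  P.-integrable [set: T] (EFin \o g) -> P.-integrable [set: T] (EFin \o h) ->
  \int[P]_y (a * g y + b * h y) = a * \int[P]_y g y + b * \int[P]_y h y.
Proof.
move=> ig ih; rewrite RintegralD//.
- by rewrite !RintegralZl.
- by have := integrableZl measurableT a ig.
- by have := integrableZl measurableT b ih.
Qed.

End Rintegral_probability.

(** * Subsets of the circle with vanishing Fourier coefficients *)

Section fourier.
Variable R : realType.
Local Notation C := (circle R).
Local Notation haar := (haar_circle R).
Local Notation re z := (complex.Re z).
Local Notation im z := (complex.Im z).

Lemma circle_val_conj (z : C) :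
  circle_val (circle_conj z) = ((circle_val z)^*)%C.
Proof. by []. Qed.

Lemma continuous_circle_conj : continuous (@circle_conj R).
Proof.
apply: continuous_circle => z.
  have -> : (fun y : C => re (circle_val (circle_conj y))) =
      (fun y => re (circle_val y)).
    by apply/funext => y; rewrite circle_val_conj; case: (circle_val y).
  exact: continuous_circle_re.
have -> : (fun y : C => im (circle_val (circle_conj y))) =
    (fun y => - im (circle_val y)).
  by apply/funext => y; rewrite circle_val_conj; case: (circle_val y).
exact: cvgN (@continuous_circle_im R z).
Qed.

Lemma measurable_prod_borel (Y : ptopologicalType) (A : set (Y * C)) :
  measurable (A : set (borel (Y * C)%type)) ->
  measurable (A : set (borel Y * borel C)).
Proof.
by move=> mA; rewrite -[X in measurable X]setTI; exact: measurable_borel_prod.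
Qed.

(** [expi] maps the compact approximants of Lebesgue measure on []0, 1]] to compact sets. *)
Lemma radon_haar : radon haar.
Proof.
apply/(@radonP R C (@hausdorff_circle R) haar) => A mA e e0.
have mEA : measurable (@expi R @^-1` A `&` `]0, 1]).
  by apply: measurableI => //; exact: measurable_preimage_expi.
have [|V [cV VA AV]] := @lebesgue_regularity_inner R _ _ mEA _ e0.
  rewrite (@le_lt_trans _ _ (@lebesgue_measure R `]0, 1]))//.
    by apply: le_measure; rewrite ?inE.
  by rewrite lebesgue_measure_itv/= lte01 ltry.
have cK : compact (@expi R @` V).
  apply: continuous_compact cV.
  by apply: continuous_subspaceT; exact: continuous_expi.
exists (@expi R @` V); split=> //; first by move=> _ [t /VA[At _] <-].
have mK := @compact_borel C (@hausdorff_circle R) _ cK.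
rewrite haar_circleE; last exact: measurableD.
apply: le_lt_trans AV; apply: le_measure; rewrite ?inE.
- apply: measurableI => //; apply: measurable_preimage_expi.
  exact: measurableD.
- by apply: measurableD => //; exact: compact_measurable.
- move=> t [[At nKt] t01]; split; first by split.
  by move=> Vt; apply: nKt; exists t.
Qed.

Lemma normr_circle_re (z : C) : `|re (circle_val z)| <= 1.
Proof.
by rewrite -(@expr_le1 _ 2)// real_normK ?num_real//; have := circle_sqr z; nra.
Qed.

Lemma circle_exprn_subproof (z : C) n : `|circle_val z ^+ n| = 1.
Proof. by rewrite normrX circle_norm expr1n. Qed.

Definition circle_exprn (z : C) n : C := Circle (circle_exprn_subproof z n).

Lemma normr_circle_im (z : C) : `|im (circle_val z)| <= 1.
Proof.
by rewrite -(@expr_le1 _ 2)// real_normK ?num_real//; have := circle_sqr z; nra.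
Qed.

Lemma haar_circle_open (U : set C) : open U -> U (expi 0) -> haar U != 0%E.
Proof.
move=> oU U0; have mU : measurable (U : set (borel C)) by exact: open_borel.
rewrite haar_circleE//; have : nbhs (0 : R) (@expi R @^-1` U).
  by apply: continuous_expi; exact: open_nbhs_nbhs.
move=> /nbhs_ballP[e /= e0 eU].
(* Capped by 1 so that []0, d]] stays in the window defining Haar measure. *)
pose d := Num.min (e / 2) 1.
have d0 : 0 < d by rewrite lt_min divr_gt0/=.
rewrite gt_eqF//.
apply: (@lt_le_trans _ _ (@lebesgue_measure R `]0, d])).
  by rewrite lebesgue_measure_itv/= lte_fin d0 -EFinD lte_fin subr0.
apply: le_measure; rewrite ?inE//.
  by apply: measurableI => //; exact: measurable_preimage_expi.
move=> t /=; rewrite !in_itv/= => /andP[t0 td].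
have [te t1] : t <= e / 2 /\ t <= 1 by move: td; rewrite le_min => /andP.
split; last by rewrite t0.
apply: eU; rewrite /ball/= sub0r normrN gtr0_norm//; lra.
Qed.

Lemma Rintegral_haar_rot (w : C) (h : C -> R) (M : R) :
  measurable_fun [set: borel C] h -> (forall z, `|h z| <= M) ->
  \int[haar]_z h (circle_mul w z) = \int[haar]_z h z.
Proof.
move=> mh hM; congr fine.
have mw := measurable_circle_mulr w.
have mf : measurable_fun [set: borel C] (EFin \o h) by exact/measurable_EFinP.
have ih : haar.-integrable [set: borel C] ((EFin \o h) \o circle_mul w).
  exact: (@integrable_bounded _ _ R haar (h \o circle_mul w) M
    (measurableT_comp mh mw) (fun z => hM _)).
have := @integral_pushforward _ _ (borel C) (borel C) R (circle_mul w) mw haar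
  setT (EFin \o h) mf ih measurableT.
rewrite preimage_setT => /esym.
rewrite /comp => ->.
by apply: eq_measure_integral => A mA _; exact: haar_circle_rot.
Qed.

(* The even trigonometric polynomials: no sines are needed, as [kernel] is
   even. *)
Inductive trig_poly : (C -> R) -> Prop :=
| trig_re k : trig_poly (fun z => re (circle_val z ^+ k))
| trig_comb a b g h : trig_poly g -> trig_poly h ->
    trig_poly (fun z => a * g z + b * h z).

(** At angle t this is cos(t / 2) ^ 2: between 0 and 1, even, and equal to 1 only at the
    identity. *)
Definition kernel (z : C) : R := (1 + re (circle_val z)) / 2.

(** This is 2 cos(t) cos((k + 1) t) = cos((k + 2) t) + cos(k t). *)
Lemma trig_kernelM g : trig_poly g -> trig_poly (fun z => kernel z * g z).
Proof.
elim=> [k|a b g1 h1 _ IHg _ IHh]; last first.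
  have -> : (fun z => kernel z * (a * g1 z + b * h1 z)) =
      (fun z => a * (kernel z * g1 z) + b * (kernel z * h1 z)).
    by apply/funext => z; ring.
  exact: trig_comb.
case: k => [|k].
  have -> : (fun z : C => kernel z * re (circle_val z ^+ 0)) =
    (fun z : C => 2^-1 * re (circle_val z ^+ 0) + 2^-1 * re (circle_val z ^+ 1)).
    by apply/funext => z; rewrite /kernel expr0 expr1/=; field.
  by apply: trig_comb; exact: trig_re.
have -> : (fun z : C => kernel z * re (circle_val z ^+ k.+1)) =
  (fun z : C => 2^-1 * re (circle_val z ^+ k.+1) + 1 *
    (4^-1 * re (circle_val z ^+ k.+2) + 4^-1 * re (circle_val z ^+ k))).
  apply/funext => z; rewrite /kernel !exprS !(complex_ReM, complex_ImM).
  have := circle_sqr z; set a := re (circle_val z); set b := im (circle_val z).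
  set c := re (_ ^+ k); set d := im (_ ^+ k) => ab.
  (* Inserting |z| ^ 2 = 1 in the last term makes the claim a polynomial identity. *)
  have {5}-> : c = c * (a ^+ 2 + b ^+ 2) by rewrite ab mulr1.
  by field.
by do 2 (apply: trig_comb; try exact: trig_re).
Qed.

Lemma trig_kernelX N : trig_poly (fun z => kernel z ^+ N).
Proof.
elim: N => [|N IH]; last first.
  by under eq_fun do rewrite exprS; exact: trig_kernelM.
have -> : (fun z => kernel z ^+ 0) = (fun z : C => re (circle_val z ^+ 0)).
  by apply/funext => z; rewrite !expr0.
exact: trig_re.
Qed.

Lemma continuous_trig g : trig_poly g -> continuous g.
Proof.
elim=> [k|a b g1 h1 _ cg _ ch z]; first exact: (@continuous_circle_expn R k).1.
exact: (cvgD (cvgM (cvg_cst a) (cg z)) (cvgM (cvg_cst b) (ch z))).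
Qed.

Lemma bounded_trig g : trig_poly g -> exists M, forall z, `|g z| <= M.
Proof.
elim=> [k|a b g1 h1 _ [M gM] _ [L hL]].
  by exists 1 => z; exact: (normr_circle_re (circle_exprn z k)).
exists (`|a| * M + `|b| * L) => z; rewrite (le_trans (ler_normD _ _))//.
by rewrite !normrM lerD// ler_wpM2l.
Qed.

Lemma bounded_integrable_indic (D : set C) (g : C -> R) M :
  measurable (D : set (borel C)) -> continuous g -> (forall z, `|g z| <= M) ->
  haar.-integrable [set: borel C] (EFin \o (fun z => g z * \1_D z)).
Proof.
move=> mD cg gM; apply: (@integrable_bounded _ _ R haar _ M).
  by apply: measurable_funM => //; apply: continuous_borelR.
move=> z; rewrite indicE; case: (_ \in _); rewrite ?mulr1// mulr0 normr0.
exact: le_trans (gM z).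
Qed.

Section fourier_trivial.
Variable B : set C.
Hypothesis mB : measurable (B : set (borel C)).
Hypothesis B0 : forall k, (0 < k)%N ->
  \int[haar]_z (re (circle_val z ^+ k) * \1_B z) = 0 /\
  \int[haar]_z (im (circle_val z ^+ k) * \1_B z) = 0.

(** Rotation by a [k]-th root of -1 negates the integral and preserves it. *)
Let haar_re k : (0 < k)%N -> \int[haar]_z re (circle_val z ^+ k) = 0.
Proof.
move=> k0; have [|w wk] := @circle_root_N1 R k; first by case: k k0.
have := @Rintegral_haar_rot w _ 1 (continuous_borelR (@continuous_circle_expn R k).1)
  (fun z => normr_circle_re (circle_exprn z k)).
have -> : \int[haar]_z re (circle_val (circle_mul w z) ^+ k) =
    \int[haar]_z (-1 * re (circle_val z ^+ k)).
  apply: eq_Rintegral => z _.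
  rewrite circle_valM exprMn -[circle_val w ^+ k]/(circle_val w ^ k%:Z) wk.
  by rewrite !mulN1r raddfN.
rewrite RintegralZl//; last first.
  apply: (@integrable_bounded _ _ R haar _ 1).
    by apply: continuous_borelR; exact: (@continuous_circle_expn R k).1.
  by move=> z; exact: (normr_circle_re (circle_exprn z k)).
by rewrite mulN1r => ?; lra.
Qed.

Let it g : trig_poly g -> haar.-integrable [set: borel C] (EFin \o g).
Proof.
move=> tg; have [M gM] := bounded_trig tg.
apply: (@integrable_bounded _ _ R haar _ M) => //.
by apply: continuous_borelR; exact: continuous_trig.
Qed.

Let itw g w : trig_poly g -> haar.-integrable [set: borel C]
  (EFin \o (fun z => g (circle_mul w z) * \1_B z)).
Proof.
move=> tg; have [M gM] := bounded_trig tg.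
apply: (@bounded_integrable_indic B _ M mB) => // z.
apply: (@continuous_comp C C R (circle_mul w) g); last exact: continuous_trig.
apply: continuous_circle_mul => ?; [exact: cst_continuous|exact: cvg_id].
Qed.

(** For k > 0, Re ((w z) ^ k) is a combination of Re (z ^ k) and Im (z ^ k), both of zero integral
    over [B], so both sides vanish; k = 0 is the constant function. On powers of [kernel] this is
    the hypothesis [qB] above. *)
Let trig_translate g : trig_poly g -> forall w,
  \int[haar]_z (g (circle_mul w z) * \1_B z) =
  fine (haar B) * \int[haar]_z g z.
Proof.
have i1 : \int[haar]_z (\1_B z : R) = fine (haar B).
  by rewrite /Rintegral integral_indic// setIT.
have i0 : \int[haar]_z (1 : R) = 1.
  exact: (congr1 fine (probability_integral_cst haar 1)).
elim=> [k|a b g1 h1 tg IHg th IHh] w; last first.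
  have ig := it tg; have ih := it th.
  rewrite [in RHS]RintegralM_comb// mulrDr !(mulrCA _ a) !(mulrCA _ b).
  rewrite -(IHg w) -(IHh w) -RintegralM_comb; [|exact: itw|exact: itw].
  by apply: eq_Rintegral => z _; ring.
case: k => [|k].
  transitivity (fine (haar B)); last first.
    suff -> : \int[haar]_z re (circle_val z ^+ 0) = \int[haar]_z (1 : R).
      by rewrite i0 mulr1.
    by apply: eq_Rintegral => z _; rewrite expr0.
  rewrite -i1; apply: eq_Rintegral => z _; by rewrite expr0 mul1r.
have [re0 im0] := B0 (ltn0Sn k).
rewrite haar_re// mulr0.
pose u := circle_val w ^+ k.+1.
have ir : haar.-integrable [set: borel C]
    (EFin \o (fun z => re (circle_val z ^+ k.+1) * \1_B z)).
  apply: (@bounded_integrable_indic B _ 1 mB).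
    exact: (@continuous_circle_expn R _).1.
  by move=> z; exact: (normr_circle_re (circle_exprn z _)).
have ii : haar.-integrable [set: borel C]
    (EFin \o (fun z => im (circle_val z ^+ k.+1) * \1_B z)).
  apply: (@bounded_integrable_indic B _ 1 mB).
    exact: (@continuous_circle_expn R _).2.
  by move=> z; exact: (normr_circle_im (circle_exprn z _)).
transitivity (\int[haar]_z (re u * (re (circle_val z ^+ k.+1) * \1_B z) +
    (- im u) * (im (circle_val z ^+ k.+1) * \1_B z))).
  apply: eq_Rintegral => z _; rewrite circle_valM exprMn complex_ReM.
  by rewrite -/u; ring.
by rewrite RintegralM_comb// re0 im0 !mulr0 addr0.
Qed.

Lemma haar_fourier_trivial : haar B = 0%E \/ haar B = 1%E.
Proof.
have e1 : circle_val (@expi R 0) = 1.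
  by rewrite circle_val_expi mulr0 cos0 sin0.
have k1 z : `|kernel z| <= 1.
  have := normr_circle_re z; rewrite /kernel !ler_norml => /andP[? ?].
  by apply/andP; split; lra.
have mc : continuous (fun p : C * C => circle_mul p.1 p.2).
  apply: continuous_circle_mul => p; [exact: cvg_fst|exact: cvg_snd].
have ic := @continuous_circle_conj.
have me w : circle_mul w (@expi R 0) = w.
  by apply: circle_val_inj; rewrite circle_valM e1 mulr1.
have rot (w : C) (A : set C) : measurable (A : set (borel C)) ->
    haar (circle_mul w @^-1` A) = haar A by exact: haar_circle_rot.
have kc : continuous (@kernel).
  have -> : kernel = (fun z => kernel z ^+ 1).
    by apply/funext => z; rewrite expr1.
  exact: continuous_trig (trig_kernelX 1).
have k0 z : 0 <= kernel z.
  by have := normr_circle_re z; rewrite /kernel ler_norml => /andP[? ?]; lra.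
have kle z : kernel z <= 1 by rewrite (le_trans (ler_norm _)).
have kq z : kernel z = 1 -> z = @expi R 0.
  move=> kz; apply: circle_val_inj; rewrite e1.
  have := circle_sqr z; move: kz; rewrite /kernel.
  case: (circle_val z) => a b /= kz ab; apply/eqP; rewrite eq_complex /=.
  have a1 : a = 1 by lra.
  by rewrite a1 eqxx/= -sqrf_eq0; apply/eqP; move: ab; rewrite a1; lra.
have ke : kernel (@expi R 0) = 1 by rewrite /kernel e1/=; field.
have ks z w : kernel (circle_mul (circle_conj w) z) =
    kernel (circle_mul (circle_conj z) w).
  rewrite /kernel !circle_valM !circle_val_conj.
  by case: (circle_val z) (circle_val w) => a b [c d] /=; congr (_ / _); ring.
apply: (peak_kernel_trivial mc ic (@circle_mulVK R) me
  (@measurable_prod_borel C) (@hausdorff_circle R) rot (@haar_circle_open)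
  radon_haar kc k0 kle kq ke ks mB) => N w.
have tN := trig_kernelX N.
rewrite (EFin_Rintegral (itw (circle_conj w) tN)) (EFin_Rintegral (it tN)).
rewrite (trig_translate tN) EFinM fineK// fin_num_measure//.
Qed.

End fourier_trivial.

End fourier.

(** * Borel sets of the complex plane *)

Section borel_complex.
Variable R : realType.
Local Notation re z := (complex.Re z).
Local Notation im z := (complex.Im z).

Lemma continuous_complex_re : continuous (fun z : R[i]^o => re (z : R[i])).
Proof.
move=> z; apply/(@cvgrPdist_lt _ _ _ _ (nbhs_filter z)) => e e0.
apply: (@filterS _ _ (nbhs_filter z) _ _ _ (nbhs_box _ e0)).
by move=> u /= [+ _]; rewrite distrC.
Qed.

Lemma continuous_complex_im : continuous (fun z : R[i]^o => im (z : R[i])).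
Proof.
move=> z; apply/(@cvgrPdist_lt _ _ _ _ (nbhs_filter z)) => e e0.
apply: (@filterS _ _ (nbhs_filter z) _ _ _ (nbhs_box _ e0)).
by move=> u /= [_]; rewrite distrC.
Qed.

(** An open subset of the plane is the union of the rational open rectangles it contains, a
    countable family. *)
Lemma measurable_complex (Y : ptopologicalType) (a b : Y -> R) :
  measurable_fun [set: borel Y] a -> measurable_fun [set: borel Y] b ->
  measurable_fun [set: borel Y]
    ((fun y => (a y +i* b y)%C) : _ -> borel R[i]^o).
Proof.
move=> ma mb.
apply: (@measurability _ _ _ (borel R[i]^o) _ _ open erefl) => _ [U oU <-].
rewrite setTI.
pose rect (c : (rat * rat) * (rat * rat)) : set R[i]^o :=
  [set z : R[i]^o | ratr c.1.1 < re (z : R[i]) < ratr c.1.2 /\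
                    ratr c.2.1 < im (z : R[i]) < ratr c.2.2].
have -> : (fun y => (a y +i* b y)%C) @^-1` U =
    \bigcup_(c in [set c | rect c `<=` U])
      ((a @^-1` `](ratr c.1.1), (ratr c.1.2)[%classic) `&`
       (b @^-1` `](ratr c.2.1), (ratr c.2.2)[%classic)).
  apply/seteqP; split=> [y /= Uy|y [c /= cU [/= ac bc]]]; last first.
    by apply: cU; move: ac bc; rewrite !in_itv.
  have /nbhsCP[e e0 eU] : nbhs ((a y +i* b y)%C : R[i]^o) U.
    exact: open_nbhs_nbhs.
  have rat_lt (x : R) : exists p : rat * rat,
      [/\ x - e < ratr p.1, ratr p.1 < x, x < ratr p.2 & ratr p.2 < x + e].
    have [p] := @rat_in_itvoo R (x - e) x ltac:(lra).
    have [q] := @rat_in_itvoo R x (x + e) ltac:(lra).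
    by rewrite !in_itv/= => /andP[? ?] /andP[? ?]; exists (p, q).
  have [p [p1 p2 p3 p4]] := rat_lt (a y).
  have [q [q1 q2 q3 q4]] := rat_lt (b y).
  exists (p, q); last by split; rewrite /= in_itv/=; apply/andP.
  move=> z /= [/andP[? ?] /andP[? ?]].
  by apply: eU; rewrite ltr_norml /=; apply/andP; split; lra.
rewrite bigcup_mkcond; apply: countable_bigcupT_measurable => [|c].
  exact: countableP.
case: ifP => _; last exact: measurable0.
apply: measurableI.
- by rewrite -[X in measurable X]setTI; apply: ma => //; exact: measurable_itv.
- by rewrite -[X in measurable X]setTI; apply: mb => //; exact: measurable_itv.
Qed.

End borel_complex.

Lemma normr_Rintegral_le d (T : measurableType d) (R : realType)
    (P : probability T R) (h : T -> R) (M : R) :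
  P.-integrable [set: T] (EFin \o h) -> (forall y, `|h y| <= M) ->
  `|\int[P]_y h y| <= M.
Proof.
move=> ih hM.
have cst_int (c : R) : P.-integrable [set: T] (EFin \o cst c).
  by apply: (@integrable_bounded _ _ R P (cst c) `|c|).
have cstE (c : R) : \int[P]_y cst c y = c.
  exact: (congr1 fine (probability_integral_cst P c)).
rewrite ler_norml -{1}(cstE (- M)) -{2}(cstE M).
by apply/andP; split; apply: le_Rintegral => //= y _;
  have := hM y; rewrite ler_norml => /andP[].
Qed.

(** * Fourier coefficients of rotated sets and of fibres *)

Section fourier_coefficients.
Variable R : realType.
Local Notation C := (circle R).
Local Notation haar := (haar_circle R).
Local Notation re z := (complex.Re z).
Local Notation im z := (complex.Im z).

(** Real and imaginary parts of the integral of z ^ k over [B]. The coefficient, with z ^ -k, is the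
    conjugate: hence [-i*] in what follows. *)
Definition fourier_re k (B : set C) :=
  \int[haar]_z (re (circle_val z ^+ k) * \1_B z).
Definition fourier_im k (B : set C) :=
  \int[haar]_z (im (circle_val z ^+ k) * \1_B z).

Let ir k (B : set C) : measurable (B : set (borel C)) ->
  haar.-integrable [set: borel C]
    (EFin \o (fun z => re (circle_val z ^+ k) * \1_B z)).
Proof.
move=> mB; apply: (@bounded_integrable_indic R B _ 1 mB).
  exact: (@continuous_circle_expn R _).1.
by move=> z; exact: (normr_circle_re (circle_exprn z _)).
Qed.

Let ii k (B : set C) : measurable (B : set (borel C)) ->
  haar.-integrable [set: borel C]
    (EFin \o (fun z => im (circle_val z ^+ k) * \1_B z)).
Proof.
move=> mB; apply: (@bounded_integrable_indic R B _ 1 mB).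
  exact: (@continuous_circle_expn R _).2.
by move=> z; exact: (normr_circle_im (circle_exprn z _)).
Qed.

(** Substitution of [w] z for z in the integral of z ^ -k over [B]. *)
Lemma fourier_rot k (B : set C) (w : C) : measurable (B : set (borel C)) ->
  (fourier_re k B -i* fourier_im k B)%C * circle_val w ^+ k =
  (fourier_re k (circle_mul w @^-1` B) -i* fourier_im k (circle_mul w @^-1` B))%C.
Proof.
move=> mB; set u := circle_val w ^+ k.
have uu : u * (u^*)%C = 1.
  by rewrite /u rmorphXn/= -exprMn circle_mulV expr1n.
have zE z : circle_val z ^+ k = u^*%C * circle_val (circle_mul w z) ^+ k.
  by rewrite circle_valM exprMn mulrA [_ * u]mulrC uu mul1r.
(* [h] takes z to w ^ -k z ^ k, so that composing it with the rotation by [w] gives z ^ k back;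
   rotation invariance is applied to [h] times the indicator of [B]. *)
pose h z := circle_mul (circle_conj (circle_exprn w k)) (circle_exprn z k).
have ch : continuous h.
  apply: continuous_circle_mul; first by move=> ?; exact: cst_continuous.
  by apply: continuous_circle; [exact: (@continuous_circle_expn R k).1|
    exact: (@continuous_circle_expn R k).2].
have mh (phi : C -> R) : continuous phi ->
    measurable_fun [set: borel C] (fun z => phi (h z) * \1_B z).
  move=> cphi; apply: measurable_funM => //; apply: continuous_borelR => z.
  by apply: (@continuous_comp _ _ _ h phi); [exact: ch|exact: cphi].
have bh (phi : C -> R) z : (forall z, `|phi z| <= 1) ->
    `|phi (h z) * \1_B z| <= 1.
  by move=> p1; rewrite indicE; case: (_ \in _); rewrite ?mulr1// mulr0 normr0.
have hE z : circle_val (h z) = u^*%C * circle_val z ^+ k by [].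
have reE : fourier_re k (circle_mul w @^-1` B) =
    re u * fourier_re k B + im u * fourier_im k B.
  rewrite -RintegralM_comb; [|exact: ir|exact: ii].
  have := Rintegral_haar_rot w (mh _ (@continuous_circle_re R))
    (fun z => bh _ z (@normr_circle_re R)).
  have -> : \int[haar]_z (re (circle_val (h (circle_mul w z))) *
      \1_B (circle_mul w z)) = fourier_re k (circle_mul w @^-1` B).
    by apply: eq_Rintegral => z _; rewrite hE -zE.
  move=> ->; apply: eq_Rintegral => z _; rewrite hE complex_ReM.
  by case: (u) => c d /=; ring.
have imE : fourier_im k (circle_mul w @^-1` B) =
    re u * fourier_im k B + (- im u) * fourier_re k B.
  rewrite -RintegralM_comb; [|exact: ii|exact: ir].
  have := Rintegral_haar_rot w (mh _ (@continuous_circle_im R))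
    (fun z => bh _ z (@normr_circle_im R)).
  have -> : \int[haar]_z (im (circle_val (h (circle_mul w z))) *
      \1_B (circle_mul w z)) = fourier_im k (circle_mul w @^-1` B).
    by apply: eq_Rintegral => z _; rewrite hE -zE.
  move=> ->; apply: eq_Rintegral => z _; rewrite hE complex_ImM.
  by case: (u) => c d /=; ring.
rewrite reE imE; case: (u) => c d.
by apply/eqP; rewrite eq_complex /=; apply/andP; split; apply/eqP; ring.
Qed.

Lemma normr_fourier_re k (B : set C) : measurable (B : set (borel C)) ->
  `|fourier_re k B| <= 1.
Proof.
move=> mB; apply: (normr_Rintegral_le (ir k mB)) => z.
rewrite indicE; case: (_ \in _); rewrite ?mulr1 ?mulr0 ?normr0//.
exact: (normr_circle_re (circle_exprn z _)).
Qed.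

Lemma normr_fourier_im k (B : set C) : measurable (B : set (borel C)) ->
  `|fourier_im k B| <= 1.
Proof.
move=> mB; apply: (normr_Rintegral_le (ii k mB)) => z.
rewrite indicE; case: (_ \in _); rewrite ?mulr1 ?mulr0 ?normr0//.
exact: (normr_circle_im (circle_exprn z _)).
Qed.

(** The constant comes from [ltc_norm], which wants both parts strictly below half of it; they are
    at most 1. *)
Lemma normr_fourier k (B : set C) : measurable (B : set (borel C)) ->
  `|(fourier_re k B -i* fourier_im k B)%C| <= ((4 : R)%:C)%C.
Proof.
move=> mB; apply/ltW/ltc_norm => /=.
  by rewrite (le_lt_trans (normr_fourier_re k mB))//; lra.
by rewrite normrN (le_lt_trans (normr_fourier_im k mB))//; lra.
Qed.

End fourier_coefficients.

Section measurable_fourier.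
Variables (R : realType) (Y : ptopologicalType) (P : probability (borel Y) R).
Local Notation C := (circle R).
Local Notation haar := (haar_circle R).
Local Notation re z := (complex.Re z).
Local Notation im z := (complex.Im z).
Variable A : set (Y * C).
Hypothesis mA : measurable (A : set (borel (Y * C)%type)).

Let measurable_coef (phi : C -> R) : continuous phi ->
  (forall z, `|phi z| <= 1) ->
  measurable_fun [set: borel Y]
    (fun y => \int[haar]_z (phi z * \1_[set z | A (y, z)] z)).
Proof.
move=> cphi phi1; have mA' := measurable_prod_borel mA.
have mF : measurable_fun [set: borel Y * borel C]
    (fun p => phi p.2 * \1_A p).
  apply: measurable_funM; last exact: measurable_indic.
  exact: (measurableT_comp (continuous_borelR cphi) measurable_snd).
have iF : (P \x haar)%E.-integrable [set: borel Y * borel C]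
    (EFin \o (fun p => phi p.2 * \1_A p)).
  apply: (@integrable_bounded _ _ R _ _ 1 mF) => p.
  by rewrite indicE; case: (_ \in _); rewrite ?mulr1// mulr0 normr0.
have := measurable_fubini_F iF.
move=> mFF; have mfine : measurable_fun [set: \bar R] (@fine R) by [].
exact: (measurableT_comp mfine mFF).
Qed.

Lemma measurable_fourier k :
  measurable_fun [set: borel Y] ((fun y =>
    (fourier_re k [set z | A (y, z)] -i* fourier_im k [set z | A (y, z)])%C)
    : _ -> borel R[i]^o).
Proof.
apply: measurable_complex.
  apply: measurable_coef; first exact: (@continuous_circle_expn R k).1.
  by move=> z; exact: (normr_circle_re (circle_exprn z k)).
have mi := measurable_coef (@continuous_circle_expn R k).2
  (fun z => normr_circle_im (circle_exprn z k)).
have mN : measurable_fun [set: R] (-%R : R -> R) by [].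
exact: (measurableT_comp mN mi).
Qed.

End measurable_fourier.

(** * The skew product *)

(** The projection intertwines [T] and [S] and maps compact sets to compact sets, so the marginal of
    [nu] is [S]-invariant and Radon. *)
Lemma marginal_unique (R : realType) (Y Z : ptopologicalType)
    (S : Y -> Y) (T : Y * Z -> Y * Z) (nu : probability (borel (Y * Z)%type) R)
    (P : probability (borel Y) R) :
  hausdorff_space Y -> hausdorff_space Z -> continuous S ->
  (forall x, (T x).1 = S x.1) ->
  radon nu -> preserves T nu ->
  (forall Q : probability (borel Y) R, radon Q -> preserves S Q ->
    forall A : set Y, measurable (A : set (borel Y)) -> Q A = P A) ->
  forall A : set Y, measurable (A : set (borel Y)) -> nu (fst @^-1` A) = P A.
Proof.
move=> hY hZ cS TS rnu Tnu uP.
pose fmix := isMeasurableFun.Build _ _ (borel (Y * Z)%type) (borel Y) fst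
  (@measurable_fst_borel Y Z).
pose p : {mfun borel (Y * Z)%type >-> borel Y} := HB.pack (@fst Y Z) fmix.
pose Q : probability (borel Y) R := distribution nu p.
have QE A : Q A = nu (fst @^-1` A) by [].
have mfst A : measurable (A : set (borel Y)) ->
    measurable (fst @^-1` A : set (borel (Y * Z)%type)).
  by apply: measurable_preimage_borel => x; exact: cvg_fst.
move=> A mA; rewrite -QE; apply: uP mA.
- apply/(radonP hY) => B mB e e0.
  have [K [cK KB nuK]] :=
    (radonP (hausdorff_prod hY hZ) nu).1 rnu _ (mfst _ mB) _ e0.
  have cf : compact (fst @` K).
    apply: continuous_compact cK.
    by apply: continuous_subspaceT => x; exact: cvg_fst.
  exists (fst @` K); split=> //; first by move=> _ [x /KB Bx <-].
  rewrite QE; apply: le_lt_trans nuK.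
  have mfK := compact_borel hY cf.
  have mK := compact_borel (hausdorff_prod hY hZ) cK.
  apply: le_measure; rewrite ?inE.
  - by apply: mfst; exact: measurableD.
  - by apply: measurableD => //; exact: mfst.
  - by move=> x [/= Bx nK]; split=> // Kx; apply: nK; exists x.
- move=> B mB; rewrite !QE -(Tnu _ (mfst _ mB)).
  by congr (nu _); apply/seteqP; split=> x /=; rewrite TS.
Qed.

(** * From a solution of the functional equation to an antiinvariant function *)

Section extension_solution.
Variables (R : realType) (Y Z : ptopologicalType).
Local Notation X := (Y * Z)%type.
Local Notation re z := (complex.Re z).
Local Notation im z := (complex.Im z).
Variables (P : probability (borel Y) R) (mu : probability (borel X) R).
Hypothesis mu_fst : forall A : set Y, measurable (A : set (borel Y)) ->
  mu (fst @^-1` A) = P A.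
Variables (S : Y -> Y) (f : Y -> Z) (mul : Z -> Z -> Z).
Let T (x : X) : X := (S x.1, mul (f x.1) x.2).
Hypotheses (cT : continuous T) (eT : ergodic mu T).
Variable w : Z.
Let rotate (x : X) : X := (x.1, mul w x.2).
Hypotheses (crot : continuous rotate) (rot_mu : preserves rotate mu).
Variable chi : Z -> R[i].
Hypothesis chi_re : continuous (fun z => re (chi z)).
Hypothesis chi_im : continuous (fun z => im (chi z)).
Hypothesis chi_neq0 : forall z, chi z != 0.
Hypothesis chiM : forall z v, chi (mul z v) = chi z * chi v.
Hypothesis chi_w : chi w = -1.

(* [g(y) chi(z)] is [T]-invariant, and changes sign under the rotation by
   [w]. *)
Lemma extension_solution_trivial (g : Y -> R[i]) :
  measurable_fun [set: borel Y] (g : _ -> borel R[i]^o) ->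
  {ae P, forall y, g (S y) * chi (f y) = g y} ->
  {ae P, forall y, g y = 0}.
Proof.
move=> mg gS; pose h (x : X) := g x.1 * chi x.2.
have mfst A : measurable (A : set (borel Y)) ->
    measurable (fst @^-1` A : set (borel X)).
  by apply: measurable_preimage_borel => x; exact: cvg_fst.
have gSX : {ae mu, forall x : X, g (S x.1) * chi (f x.1) = g x.1}.
  case: gS => N [mN N0 UN]; exists (fst @^-1` N); split; first exact: mfst.
    by rewrite [LHS]mu_fst.
  by move=> x /= nU; apply: UN.
have hT : {ae mu, forall x, h (T x) = h x}.
  move: gSX; apply: (@filterS _ _ (ae_filter_ringOfSetsType mu)) => x gx.
  by rewrite /h /T /= chiM mulrA gx.
have hr x : h (rotate x) = - h x.
  by rewrite /h /rotate /= chiM chi_w mulN1r mulrN.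
have mre : measurable_fun [set: borel Y] (fun y => re (g y)).
  exact: (measurableT_comp (continuous_borelR (@continuous_complex_re R)) mg).
have mim : measurable_fun [set: borel Y] (fun y => im (g y)).
  exact: (measurableT_comp (continuous_borelR (@continuous_complex_im R)) mg).
have m1 := measurableT_comp mre (@measurable_fst_borel Y Z).
have m2 := measurableT_comp mim (@measurable_fst_borel Y Z).
have m3 := measurableT_comp (continuous_borelR chi_re) (@measurable_snd_borel Y Z).
have m4 := measurableT_comp (continuous_borelR chi_im) (@measurable_snd_borel Y Z).
have mhr : measurable_fun [set: borel X] (fun x => re (h x)).
  have -> : (fun x => re (h x)) =
      (fun x => re (g x.1) * re (chi x.2) - im (g x.1) * im (chi x.2)).
    by apply/funext => x; rewrite complex_ReM.
  by apply: measurable_funB; apply: measurable_funM.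
have mhi : measurable_fun [set: borel X] (fun x => im (h x)).
  have -> : (fun x => im (h x)) =
      (fun x => re (g x.1) * im (chi x.2) + im (g x.1) * re (chi x.2)).
    by apply/funext => x; rewrite complex_ImM.
  by apply: measurable_funD; apply: measurable_funM.
have h0 := antiinvariant_complex_ae0 cT crot eT rot_mu mhr mhi hT hr.
have mG : measurable ([set y | g y = 0] : set (borel Y)).
  have := mg measurableT [set 0]; rewrite setTI; apply.
  apply: closed_borel; apply: accessible_closed_set1.
  exact/hausdorff_accessible/norm_hausdorff.
have mGC : measurable (~` [set y | g y = 0] : set (borel Y)).
  exact: measurableC.
exists (~` [set y | g y = 0]); split=> //.
(* [chi] never vanishes, so [h] is nonzero over every point where [g] is. *)
rewrite -(mu_fst mGC).
case: h0 => N [mN N0 gN]; apply/eqP; rewrite -measure_le0 -N0.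
apply: le_measure; rewrite ?inE//; first exact: mfst.
move=> x /= gx; apply: gN => /= /eqP.
by rewrite mulf_eq0 (negbTE (chi_neq0 _)) orbF => /eqP.
Qed.

End extension_solution.

(** * Ergodicity of the skew product and the functional equation *)

Section directions.
Variables (R : realType) (Y : ptopologicalType) (P : probability (borel Y) R).
Local Notation C := (circle R).
Local Notation haar := (haar_circle R).
Local Notation re z := (complex.Re z).
Local Notation im z := (complex.Im z).
Variables (S : Y -> Y) (f : Y -> circle R).
Hypotheses (cS : continuous S) (cf : continuous f).
Let mu := times_haar P.
Let T := skew_product S f.

Lemma times_haarE (A : set (Y * C)) :
  times_haar P A = (\int[P]_y haar [set z | A (y, z)])%E.
Proof.
rewrite /times_haar /distribution /pushforward /= /product_measure1.
apply: eq_integral => y _; congr (uniform_prob _ _).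
by apply/seteqP; split=> z; rewrite /xsection/= inE.
Qed.

Lemma solution_trivial_ergodic : ergodic P S ->
  (forall k (g : Y -> R[i]), Linfty P g ->
    {ae P, forall y, g (S y) * circle_val (f y) ^+ k.+1 = g y} ->
    {ae P, forall y, g y = 0}) ->
  forall A : set (Y * C), measurable (A : set (borel (Y * C)%type)) ->
    T @^-1` A = A -> mu A = 0%E \/ mu A = 1%E.
Proof.
move=> [SP eP] H A mA TA.
pose sec y := [set z : C | A (y, z)].
have msec y : measurable (sec y : set (borel C)).
  exact: (measurable_section (@measurable_prod_borel R Y) y mA).
have AE y z : A (S y, circle_mul (f y) z) = A (y, z) by rewrite -[in RHS]TA.
(* Invariance of [A] makes the fibres over [y] and [S y] rotates of each other, so the coefficients
   solve the equation at every point. *)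
have secE y : sec y = circle_mul (f y) @^-1` sec (S y).
  by apply/seteqP; split=> z; rewrite /sec /= AE.
pose g k y := (fourier_re k (sec y) -i* fourier_im k (sec y))%C.
have gE k y : g k (S y) * circle_val (f y) ^+ k = g k y.
  by rewrite /g (fourier_rot k (f y) (msec (S y))) -secE.
have g0 k : {ae P, forall y, g k.+1 y = 0}.
  apply: (H k); last by apply: aeW => y; exact: gE.
  split; first exact: measurable_fourier.
  by exists 4; apply: aeW => y; exact: normr_fourier.
have secP : {ae P, forall y, haar (sec y) = 0%E \/ haar (sec y) = 1%E}.
  move: (ae_foralln g0).
  apply: (@filterS _ _ (ae_filter_ringOfSetsType P)) => y gy.
  apply: haar_fourier_trivial => // -[//|k] _.
  have /eqP := gy k; rewrite /g eq_complex/= oppr_eq0 => /andP[/eqP g1 /eqP g2].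
  by split; [exact: g1|exact: g2].
have mh := measurable_fiber (@measurable_prod_borel R Y) haar mA.
(* The points with conull fibre. Rotates have the same Haar measure, so [E] is strictly invariant;
   up to null sets the fibre measure is the indicator of [E]. *)
pose E := [set y | haar (sec y) = 1%E].
have mE : measurable (E : set (borel Y)).
  have := mh measurableT [set 1%E] (emeasurable_set1 _); rewrite setTI.
  by [].
have SE : S @^-1` E = E.
  have hsec y : haar (sec y) = haar (sec (S y)).
    by rewrite [in LHS](secE y); exact: haar_circle_rot.
  by apply/seteqP; split=> y; rewrite /E /mkset /preimage (hsec y).
have muE : mu A = (\int[P]_y haar (sec y))%E by exact: times_haarE.
have [PE|PE] := eP _ mE SE; [left|right]; rewrite muE.
- transitivity (\int[P]_y (cst 0 y))%E; last by rewrite integral0.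
  apply: ae_eq_integral => //.
  have : {ae P, forall y, ~ E y}.
    by exists E; split=> // y /= /contrapT.
  by move: secP; apply: (@filterS2 _ _ (ae_filter_ringOfSetsType P)) => y [].
- transitivity (\int[P]_y (cst 1%:E y))%E; last by rewrite probability_integral_cst.
  apply: ae_eq_integral => //.
  have : {ae P, forall y, E y}.
    exists (~` E); split; [exact: measurableC| |by []].
    by rewrite [LHS]probability_setC// PE subee.
  by apply: (@filterS _ _ (ae_filter_ringOfSetsType P)) => y.
Qed.

Lemma times_haar_fst (A : set Y) : measurable (A : set (borel Y)) ->
  times_haar P (fst @^-1` A) = P A.
Proof.
move=> mA; rewrite (_ : _ @^-1` _ = A `*` setT).
  by rewrite times_haarX// probability_setT mule1.
by apply/seteqP; split=> x //= [].
Qed.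

Lemma continuous_circle_mulp : continuous (fun p : C * C => circle_mul p.1 p.2).
Proof. by apply: continuous_circle_mul => p; [exact: cvg_fst|exact: cvg_snd]. Qed.

Lemma continuous_skew_product : continuous T.
Proof. exact: (continuous_skew continuous_circle_mulp cS cf). Qed.

(** A skew product over the identity with constant cocycle, so the results on skew products give its
    continuity and the invariance of [mu]. *)
Let rotate (w : C) (x : Y * C) : Y * C := (x.1, circle_mul w x.2).

Let cid : continuous (@idfun Y). Proof. by move=> x; exact: cvg_id. Qed.

Let cw (w : C) : continuous (fun _ : Y => w).
Proof. by move=> x; exact: cst_continuous. Qed.

Let continuous_rotate w : continuous (rotate w).
Proof. exact: (continuous_skew continuous_circle_mulp cid (@cw w)). Qed.

Let haar_rot (w : C) (A : set C) : measurable (A : set (borel C)) ->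
  haar (circle_mul w @^-1` A) = haar A.
Proof. exact: haar_circle_rot. Qed.

Let muE (A : set (Y * C)) : measurable (A : set (borel (Y * C)%type)) ->
  mu A = (\int[P]_y haar [set z | A (y, z)])%E.
Proof. by move=> _; exact: times_haarE. Qed.

Lemma times_haar_preserves : preserves S P -> preserves T mu.
Proof.
exact: (skew_preserves continuous_circle_mulp (@measurable_prod_borel R Y)
  cS cf haar_rot muE).
Qed.

Let rotate_preserves w : preserves (rotate w) mu.
Proof.
exact: (skew_preserves continuous_circle_mulp (@measurable_prod_borel R Y)
  cid (@cw w) haar_rot muE).
Qed.

Lemma ergodic_solution_trivial (n : int) (g : Y -> R[i]) :
  ergodic mu T -> n != 0 ->
  measurable_fun [set: borel Y] (g : _ -> borel R[i]^o) ->
  {ae P, forall y, g (S y) * circle_val (f y) ^ n = g y} ->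
  {ae P, forall y, g y = 0}.
Proof.
move=> eT n0 mg gS; have [w wn] := circle_root_N1 R n0.
have [czr czi] := continuous_circle_exprz R n.
have chiM (z v : C) :
    circle_val (circle_mul z v) ^ n = circle_val z ^ n * circle_val v ^ n.
  by rewrite circle_valM exprzMl ?unitfE ?circle_neq0.
exact: (extension_solution_trivial times_haar_fst continuous_skew_product eT
  (@continuous_rotate w) (@rotate_preserves w) czr czi
  (fun z => expfz_neq0 n (circle_neq0 z)) chiM wn mg gS).
Qed.

End directions.

Lemma radon_times_haar (R : realType) (Y : ptopologicalType)
    (P : probability (borel Y) R) :
  compact [set: Y] -> hausdorff_space Y -> radon P -> radon (times_haar P).
Proof.
move=> cY hY rP.
have cX : compact [set: (Y * circle R)%type].
  by rewrite -setXTT; apply: compact_setX => //; exact: compact_circle.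
exact: (radon_product (@measurable_prod_borel R Y) (@times_haarX R Y P) hY
  (@hausdorff_circle R) rP (@radon_haar R) cX).
Qed.

Lemma ergodic_times_haar_unique (R : realType) (Y : ptopologicalType)
    (P : probability (borel Y) R) (S S' : Y -> Y) (f : Y -> circle R)
    (nu : probability (borel (Y * circle R)%type) R) :
  compact [set: Y] -> hausdorff_space Y -> radon P ->
  continuous S -> continuous S' -> continuous f -> cancel S S' -> cancel S' S ->
  ergodic (times_haar P) (skew_product S f) ->
  radon nu -> preserves (skew_product S f) nu ->
  (forall A, measurable (A : set (borel Y)) -> nu (fst @^-1` A) = P A) ->
  forall A : set (Y * circle R),
    measurable (A : set (borel (Y * circle R)%type)) ->
    nu A = times_haar P A.
Proof.
move=> cY hY rP cS cS' cf SK S'K emu rnu Tnu nuP A mA.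
have ie (z : circle R) : circle_mul (circle_conj (@expi R 0)) z = z.
  apply: circle_val_inj; rewrite circle_valM circle_val_conj circle_val_expi.
  by rewrite mulr0 cos0 sin0 -[X in X * _]/(1%:C)^*%C rmorph1 mul1r.
exact: (ergodic_extension_unique (@circle_mulA R) (@circle_mulC R)
  (@continuous_circle_mulp R) (@continuous_circle_conj R) (@circle_mulKV R)
  (@circle_mulVK R) ie (@measurable_prod_borel R Y)
  (@measurable_prod_borel R (circle R)) hY (@hausdorff_circle R) cS cS' cf
  SK S'K (fun w A mA => @haar_circle_rot R w A mA) (@haar_circle_open R)
  (fun A _ => times_haarE P A) (radon_times_haar cY hY rP) emu rnu Tnu nuP mA).
Qed.
Lemma uniquely_ergodic_times_haar_ergodic (R : realType) (Y : ptopologicalType)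
    (P : probability (borel Y) R) (S : Y -> Y) (f : Y -> circle R) :
  compact [set: Y] -> hausdorff_space Y -> radon P ->
  continuous S -> continuous f -> preserves S P ->
  uniquely_ergodic R (skew_product S f) ->
  ergodic (times_haar P) (skew_product S f).
Proof.
move=> cY hY rP cS cf SP ueT.
exact: (@uniquely_ergodic_ergodic R (Y * circle R)%type (times_haar P)
  (skew_product S f) (hausdorff_prod hY (@hausdorff_circle R)) ueT
  (radon_times_haar cY hY rP) (times_haar_preserves cS cf SP)).
Qed.

Theorem proposition5p1 (R : realType) (Xo : ptopologicalType)
    (Xo_compact : compact [set: Xo]) (Xo_hausdorff : hausdorff_space Xo)
    (mu_o : probability (borel Xo) R) (mu_o_radon : radon mu_o)
    (To : Xo -> Xo) (To_homeo : homeomorphism To)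
    (To_mu_o : preserves To mu_o)
    (f : Xo -> circle R) (f_cont : continuous f)
    (To_ue : uniquely_ergodic R To) :
  let mu := times_haar mu_o in
  let T := skew_product To f in
  let cond_i := ergodic mu T in
  let cond_ii := forall n : int, n != 0 ->
    ~ exists g : Xo -> R[i],
        [/\ Linfty mu_o g,
            {ae mu_o, forall x, g (To x) * circle_val (f x) ^ n = g x} &
            ~ {ae mu_o, forall x, g x = 0}] in
  let cond_iii := uniquely_ergodic R T in
  (cond_i <-> cond_ii) /\ (cond_ii <-> cond_iii).
Proof.
move=> mu T cond_i cond_ii cond_iii.
have [cS [S' [cS' SK S'K]]] := To_homeo.
have eo := uniquely_ergodic_ergodic Xo_hausdorff To_ue mu_o_radon To_mu_o.
have uP (Q : probability (borel Xo) R) := @uniquely_ergodic_eq R Xo mu_o Q To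
  To_ue mu_o_radon To_mu_o.
have i_ii : cond_i -> cond_ii.
  move=> emu n n0 [g [[mg _] gT]]; apply.
  exact: (ergodic_solution_trivial cS f_cont emu n0 mg gT).
have ii_i : cond_ii -> cond_i.
  move=> H; split; first exact: (times_haar_preserves cS f_cont To_mu_o).
  (* Exponents [k.+1] are enough: the indicator of a fibre is real, so its coefficients of opposite
     index are conjugate. *)
  exact: (@solution_trivial_ergodic R Xo mu_o To f eo (fun k g Lg gT =>
    contrapT (fun g0 => H k.+1%:Z isT (ex_intro _ g (And3 Lg gT g0))))).
(* Unique ergodicity of the base enters through [uP], which identifies the marginal of a competing
   measure with [mu_o]. *)
have i_iii : cond_i -> cond_iii.
  move=> emu; exists mu; split.
  - exact: (radon_times_haar Xo_compact Xo_hausdorff mu_o_radon).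
  - exact: (times_haar_preserves cS f_cont To_mu_o).
  - exact: (fun Q rQ TQ => @ergodic_times_haar_unique R Xo mu_o To S' f Q
      Xo_compact Xo_hausdorff mu_o_radon cS cS' f_cont SK S'K emu rQ TQ
      (@marginal_unique R Xo (circle R) To T Q mu_o Xo_hausdorff
        (@hausdorff_circle R) cS (fun x => erefl) rQ TQ uP)).
have iii_i : cond_iii -> cond_i.
  exact: (uniquely_ergodic_times_haar_ergodic Xo_compact Xo_hausdorff mu_o_radon cS f_cont
    To_mu_o).
by split; split => [H|]; [exact: i_ii|exact: ii_i|exact/i_iii/ii_i|
  move=> H; exact/i_ii/iii_i].
Qed.
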